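(* Let $s$ be an integer of the form $s=3^{\ell_1}4^{\ell_2}5^{\ell_3}6^{\ell_4}+1$ with integers $\ell_1,\ell_2,\ell_3,\ell_4\ge 0$, and define $R(s)=6(s-1)$ if $\ell_1=\ell_2=\ell_3=0$; $R(s)=5(s-1)$ if $\ell_1=\ell_2=0$ and $\ell_3\ne0$; $R(s)=4(s-1)$ if $\ell_1=0$ and $\ell_2\neq 0$; and $R(s)=3(s-1)$ if $\ell_1\neq 0$. Then for every integer $r$ with $2s\le r\le R(s)$ there exist constants $C=C(\ell_1,\ell_2,\ell_3,\ell_4)>0$ and $\epsilon=\epsilon(\ell_1,\ell_2,\ell_3,\ell_4)>0$ such that for every integer $n\ge r$ there exists an explicit construction of an $(n,r,s)$-system with independence number at most $Cn^{1-\epsilon}$.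
   Context: An $r$-uniform hypergraph ($r$-graph) $\mathcal{H}$ is a family of $r$-subsets of a finite vertex set $V(\mathcal{H})$. A set $I\subset V(\mathcal{H})$ is independent if it contains no edge of $\mathcal{H}$; the independence number $\alpha(\mathcal{H})$ is the maximum size of an independent set. For integers $n\ge r\ge s\ge 1$, an $(n,r,s)$-system is an $r$-graph on $n$ vertices in which every pair of distinct edges has intersection of size less than $s$. For fixed $r\ge s\ge1$, ''there is an explicit construction of an $(n,r,s)$-system with property $\mathcal{P}$'' means there is an algorithm which, on input any integer $n$, runs in time polynomial in $n$ and outputs an $(n,r,s)$-system with property $\mathcal{P}$. *)

(* Defs.v *)
From mathcomp Require Import all_boot.

Set Implicit Arguments.
Unset Strict Implicit.
Unset Printing Implicit Defensive.

Section Hypergraphs.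
Variable T : finType.
Implicit Types (H : {set {set T}}) (I : {set T}).

Definition uniform (r : nat) H : Prop := forall e, e \in H -> #|e| = r.

Definition independent H I : bool := [forall e in H, ~~ (e \subset I)].

Definition independence_number H : nat :=
  \max_(I : {set T} | independent H I) #|I|.

End Hypergraphs.

Definition nrs_system (n r s : nat) (H : {set {set 'I_n}}) : Prop :=
  [/\ 1 <= s <= r, r <= n, uniform r H &
      forall e f, e \in H -> f \in H -> e != f -> #|e :&: f| < s].

(* Algorithms are structured programs for a random access machine with
   registers, an indirectly addressed memory and a write-only output tape, all
   holding natural numbers.  Every elementary instruction and every test costs
   one time unit.  As addition and truncated subtraction are the only
   arithmetic, an instruction lengthens numbers by at most one bit, so that
   polynomial time here agrees with polynomial time on Turing machines. *)
Inductive prog : Type :=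
  | Const  of nat & nat           (* x := k        *)
  | Add    of nat & nat & nat     (* x := y + z    *)
  | Sub    of nat & nat & nat     (* x := y - z    *)
  | Fetch  of nat & nat           (* x := mem[y]   *)
  | Store  of nat & nat           (* mem[x] := y   *)
  | Output of nat
  | Seq    of prog & prog
  | If     of nat & prog & prog   (* first branch if x <> 0 *)
  | While  of nat & prog.         (* as long as x <> 0      *)

Record state : Type := State {
  reg : nat -> nat;
  mem : nat -> nat;
  out : seq nat }.

Definition upd (f : nat -> nat) (i v : nat) : nat -> nat :=
  fun j => if j == i then v else f j.

Definition set_reg (st : state) (x v : nat) : state :=
  State (upd (reg st) x v) (mem st) (out st).

Definition set_mem (st : state) (a v : nat) : state :=
  State (reg st) (upd (mem st) a v) (out st).

Definition emit (st : state) (v : nat) : state :=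
  State (reg st) (mem st) (rcons (out st) v).

(* The input n is in register 0; every other register and cell holds 0. *)
Definition init (n : nat) : state :=
  State (upd (fun=> 0) 0 n) (fun=> 0) [::].

(* exec p st t st' : started in st, p halts in st' after exactly t steps. *)
Inductive exec : prog -> state -> nat -> state -> Prop :=
  | ExecConst st x k : exec (Const x k) st 1 (set_reg st x k)
  | ExecAdd st x y z :
      exec (Add x y z) st 1 (set_reg st x (reg st y + reg st z))
  | ExecSub st x y z :
      exec (Sub x y z) st 1 (set_reg st x (reg st y - reg st z))
  | ExecFetch st x y :
      exec (Fetch x y) st 1 (set_reg st x (mem st (reg st y)))
  | ExecStore st x y :
      exec (Store x y) st 1 (set_mem st (reg st x) (reg st y))
  | ExecOutput st x : exec (Output x) st 1 (emit st (reg st x))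
  | ExecSeq p q st1 st2 st3 t u :
      exec p st1 t st2 -> exec q st2 u st3 -> exec (Seq p q) st1 (t + u) st3
  | ExecIfTrue x p q st st' t :
      reg st x != 0 -> exec p st t st' -> exec (If x p q) st t.+1 st'
  | ExecIfFalse x p q st st' t :
      reg st x = 0 -> exec q st t st' -> exec (If x p q) st t.+1 st'
  | ExecWhileDone x p st : reg st x = 0 -> exec (While x p) st 1 st
  | ExecWhileLoop x p st1 st2 st3 t u :
      reg st1 x != 0 -> exec p st1 t st2 -> exec (While x p) st2 u st3 ->
      exec (While x p) st1 (t + u).+1 st3.

Lemma exec_det p st t1 st1 t2 st2 :
  exec p st t1 st1 -> exec p st t2 st2 -> t1 = t2 /\ st1 = st2.
Proof.
move=> h1; elim: h1 t2 st2 => {p st t1 st1}.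
1-6: by move=> *; match goal with h : exec _ _ _ _ |- _ => inversion h end.
- move=> p q sa sb sc t u _ IHp _ IHq t2 st2 h; inversion h; subst.
  match goal with h1 : exec p _ _ _ |- _ => have [-> e] := IHp _ _ h1 end.
  subst.
  by match goal with h1 : exec q _ _ _ |- _ => have [-> ->] := IHq _ _ h1 end.
- move=> x p q sa sb t nz _ IH t2 st2 h; inversion h; subst.
    match goal with h1 : exec p _ _ _ |- _ => by have [-> ->] := IH _ _ h1 end.
  by match goal with e : reg _ _ = 0 |- _ => rewrite e in nz end.
- move=> x p q sa sb t z _ IH t2 st2 h; inversion h; subst.
    by match goal with e : is_true (_ != 0) |- _ => rewrite z in e end.
  match goal with h1 : exec q _ _ _ |- _ => by have [-> ->] := IH _ _ h1 end.
- move=> x p sa z t2 st2 h; inversion h; subst => //.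
  by match goal with e : is_true (_ != 0) |- _ => rewrite z in e end.
- move=> x p sa sb sc t u nz _ IHp _ IHw t2 st2 h; inversion h; subst.
    by match goal with e : reg _ _ = 0 |- _ => rewrite e in nz end.
  match goal with h1 : exec p _ _ _ |- _ => have [-> e] := IHp _ _ h1 end.
  subst.
  by match goal with h1 : exec (While _ _) _ _ _ |- _ =>
    have [-> ->] := IHw _ _ h1 end.
Qed.

(* The edges are written one after the other, each as its r vertices in any
   order. *)
Definition lists_edges (n r : nat) (w : seq nat) (H : {set {set 'I_n}}) : Prop :=
  exists es : seq (r.-tuple 'I_n),
    w = flatten [seq [seq val v | v <- tval e] | e <- es] /\
    H = [set [set v in tval e] | e in es].

Definition explicit_construction (r s : nat)
    (P : forall n : nat, {set {set 'I_n}} -> Prop) : Prop :=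
  exists (p : prog) (c k : nat), forall n : nat, r <= n ->
    exists (t : nat) (st : state) (H : {set {set 'I_n}}),
      [/\ exec p (init n) t st, t <= c * n ^ k + c,
          lists_edges r (out st) H, nrs_system r s H & P n H].

Definition s_of (l1 l2 l3 l4 : nat) : nat :=
  3 ^ l1 * 4 ^ l2 * 5 ^ l3 * 6 ^ l4 + 1.

(* The exponents are not determined by s (36 = 3 ^ 2 * 4 = 6 ^ 2), hence the
   upper bound for r is a function of the exponents. *)
Definition R_of (l1 l2 l3 l4 : nat) : nat :=
  let s := s_of l1 l2 l3 l4 in
  if l1 != 0 then 3 * (s - 1)
  else if l2 != 0 then 4 * (s - 1)
  else if l3 != 0 then 5 * (s - 1)
  else 6 * (s - 1).

(* Main.v *)
Require Import Defs.
From mathcomp Require Import all_boot all_order all_algebra.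
From mathcomp Require Import all_classical all_reals all_analysis.
From mathcomp Require Import ring lra zify.

(* As s >= 2, it suffices to construct linear r-graphs, that is edges meeting in
   at most one vertex, whose independence number is a power of n below n.  The
   vertices are the pairs (tau, u) with tau in F = 'F_q and u in Z, a space of
   bounded dimension over F, and every line {(tau, x + tau z)} receives at most
   one edge, the r points with abscissas t_1, ..., t_r, where t = hash z depends
   on the slope z only.  Two vertices with distinct abscissas lie on one line,
   so the system is linear.

   Let A contain no edge, and let M_t be the number of lines with all r points
   over t_1, ..., t_r in A.  By the power mean inequality the average of M_t over
   t is at least density(A)^r times the number of lines.  On the other hand, if
   the t_i are distinct, M_t counts only lines with hash z <> t.  If
   w(z) = q^r [hash z = t] - 1, then
     sum_(x,z) prod_i 1_A(t_i, x + t_i z) w(z) = - M_t,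
   and r applications of the Cauchy-Schwarz inequality bound the left-hand side
   by the sum of w over the r-dimensional cubes of Z.  The hash consists of
   polynomials of degree < 2^r whose coefficients are themselves coordinates
   of z, hence its values at the 2^r vertices of a cube are independent, unless
   the points at which these polynomials are evaluated collide, which happens
   for a tiny fraction of the cubes.  Thus M_t is a fraction O(1/q) of all lines
   and density(A)^r = O(1/q), where q is of order at least a power of n. *)

Set Implicit Arguments.
Unset Strict Implicit.
Unset Printing Implicit Defensive.
Import Order.TTheory GRing.Theory Num.Theory.

Local Open Scope ring_scope.

(** * Van der Corput estimates over a finite field *)

Section Means.
Variable R : realDomainType.

(** Chebyshev's sum inequality: the double sum of the nonnegative products expands to twice the
    difference of the two sides. *)
Lemma chebyshev_sum (T : finType) (f g : T -> R) :
  (forall i j, 0 <= (f i - f j) * (g i - g j)) ->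
  (\sum_i f i) * (\sum_i g i) <= #|T|%:R * \sum_i f i * g i.
Proof.
move=> fg; have: 0 <= \sum_i \sum_j (f i - f j) * (g i - g j).
  by apply: sumr_ge0 => i _; apply: sumr_ge0.
have -> : \sum_i \sum_j (f i - f j) * (g i - g j) =
    (#|T|%:R * (\sum_i f i * g i) - (\sum_i f i) * (\sum_i g i)) *+ 2.
  under eq_bigr => i _.
    rewrite (eq_bigr (fun j => (f i * g i + f j * g j) - (f i * g j + f j * g i))).
      rewrite sumrB !big_split /= sumr_const -mulr_sumr -mulr_suml.
      over.
    by move=> j _; ring.
  rewrite sumrB !big_split /= sumr_const -mulr_sumr -mulr_suml -sumrMnl.
  by rewrite cardT -cardE /= sumrMnl -mulr_natl; ring.
by rewrite pmulrn_lge0 // subr_ge0.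
Qed.

Lemma power_mean (T : finType) (f : T -> R) k : (forall i, 0 <= f i) ->
  (\sum_i f i) ^+ k.+1 <= #|T|%:R ^+ k * \sum_i f i ^+ k.+1.
Proof.
move=> f0; elim: k => [|k IH]; first by rewrite expr0 mul1r.
rewrite exprS; apply: le_trans (_ : (\sum_i f i) * (#|T|%:R ^+ k * \sum_i f i ^+ k.+1) <= _).
  by rewrite ler_wpM2l ?sumr_ge0.
rewrite mulrCA exprSr -mulrA ler_wpM2l ?exprn_ge0 //.
under [X in _ <= _ * X]eq_bigr do rewrite exprS.
apply: chebyshev_sum => i j.
have [le_ij|/ltW le_ij] := lerP (f i) (f j).
  by rewrite mulr_le0 // subr_le0 // lerXn2r // nnegrE.
by rewrite mulr_ge0 // subr_ge0 // lerXn2r // nnegrE.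
Qed.

Lemma norm_power_mean (T : finType) (f : T -> R) k : (0 < k)%N ->
  `|\sum_i f i| ^+ k <= #|T|%:R ^+ k.-1 * \sum_i `|f i| ^+ k.
Proof.
case: k => // k _; apply: le_trans (power_mean k _) => //.
by rewrite lerXn2r ?nnegrE ?sumr_ge0 // ler_norm_sum.
Qed.

End Means.

Section Vdc.
Variables (F : finFieldType) (I : finType).
Local Notation Z := {ffun I -> F^o}.
Local Notation N := (#|{: Z}|%:R : int).

(* Inside the absolute value, w is multiplied over the cube spanned by the r
   summation variables h and based at z. *)
Fixpoint cubesum (r : nat) (w : Z -> int) : int :=
  if r is r'.+1 then \sum_(h : Z) cubesum r' (fun z => w z * w (z + h))
  else `|\sum_(z : Z) w z|.

(** The translation by [- (t r *: z)] frees the factor [g r] of [z], so that Cauchy-Schwarz over [x]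
    removes it. Expanding the remaining square and writing the second slope as [z + h] gives the
    right-hand side. *)
Lemma van_der_corput_step (t : nat -> F) (g : nat -> Z -> int) (w : Z -> int) r :
  (forall i u, `|g i u| <= 1) ->
  `|\sum_(x : Z) \sum_(z : Z) (\prod_(i < r.+1) g i (x + t i *: z)) * w z| ^+ 2 <=
  N * \sum_(h : Z) \sum_(x : Z) \sum_(z : Z)
    (\prod_(i < r) (g i (x + (t i - t r) *: z)
                    * g i (x + (t i - t r) *: z + (t i - t r) *: h))) *
    (w z * w (z + h)).
Proof.
move=> g1.
pose G (x : Z) := \sum_(z : Z) (\prod_(i < r) g i (x + (t i - t r) *: z)) * w z.
have -> : \sum_(x : Z) \sum_(z : Z) (\prod_(i < r.+1) g i (x + t i *: z)) * w z =
    \sum_(x : Z) g r x * G x.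
  rewrite exchange_big /=.
  under [RHS]eq_bigr do rewrite mulr_sumr.
  rewrite [RHS]exchange_big; apply: eq_bigr => z _ /=.
  rewrite (reindex_inj (addIr (- (t r *: z)))) /=; apply: eq_bigr => x _.
  rewrite big_ord_recr /= subrK mulrCA -mulrA; congr (_ * (_ * _)).
  by apply: eq_bigr => i _; rewrite scalerBl addrAC addrA.
apply: le_trans (norm_power_mean _ _) _ => //.
rewrite expr1 ler_wpM2l //.
apply: le_trans (_ : \sum_(x : Z) G x * G x <= _).
  apply: ler_sum => x _; rewrite normrM exprMn.
  rewrite (real_normK (num_real (G x))) -expr2 ler_piMl ?sqr_ge0 //.
  by rewrite exprn_ile1.
rewrite [leRHS]exchange_big; apply: ler_sum => x _ /=.
rewrite exchange_big /= {1}/G mulr_suml; apply: ler_sum => z _.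
rewrite /G mulr_sumr (reindex_inj (addrI z)) /= le_eqVlt; apply/orP; left.
apply/eqP/eq_bigr => h _; rewrite big_split /= mulrACA; congr (_ * _ * _).
by apply: eq_bigr => i _; rewrite scalerDr addrA.
Qed.

(** Each Cauchy-Schwarz step removes one function, replaces the others by
    [g i u * g i (u + (t i - t r) *: h)], still bounded by 1, and the weight by [w z * w (z + h)].
    After [r] steps only the weight is left. *)
Lemma van_der_corput r (t : nat -> F) (g : nat -> Z -> int) (w : Z -> int) :
  (forall i u, `|g i u| <= 1) ->
  `|\sum_(x : Z) \sum_(z : Z) (\prod_(i < r) g i (x + t i *: z)) * w z| ^+ (2 ^ r) <=
  N ^+ (2 * 2 ^ r - 1 - r) * cubesum r w.
Proof.
elim: r t g w => [|r IH] t g w g1.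
  rewrite expr1 /= muln1 !subn0 expr1.
  under eq_bigr => x _ do under eq_bigr => z _ do rewrite big_ord0 mul1r.
  by rewrite sumr_const -[_ *+ #|_|]mulr_natl normrM normr_nat.
rewrite expnS exprM.
have h2 : (0 < 2 ^ r)%N by rewrite expn_gt0.
have step := van_der_corput_step t w r g1; set rhs := (X in _ <= X) in step.
have rhs0 : 0 <= rhs by apply: le_trans step; rewrite exprn_ge0.
apply: le_trans (_ : rhs ^+ (2 ^ r) <= _).
  by rewrite lerXn2r ?nnegrE ?exprn_ge0.
rewrite -[rhs ^+ _]ger0_norm ?exprn_ge0 // normrX normrM exprMn normr_nat.
(* [N ^+ (2 ^ r)] comes from raising the previous step to the power [2 ^ r], and [N ^+ (2 ^ r).-1]
   from the power mean over [h]. *)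
apply: le_trans (_ : N ^+ (2 ^ r) * (N ^+ (2 ^ r).-1 *
   (\sum_(h : Z) N ^+ (2 * 2 ^ r - 1 - r) * cubesum r (fun z => w z * w (z + h)))) <= _).
  rewrite ler_wpM2l ?exprn_ge0 //.
  apply: le_trans (norm_power_mean _ h2) _; rewrite ler_wpM2l ?exprn_ge0 //.
  apply: ler_sum => h _.
  apply: (IH (fun i => t i - t r) (fun i u => g i u * g i (u + (t i - t r) *: h))
             (fun z => w z * w (z + h))) => i u.
  by rewrite normrM mulr_ile1.
rewrite -mulr_sumr /= !mulrA -!exprD le_eqVlt; apply/orP; left; apply/eqP.
congr (_ ^+ _ * _); have : (r < 2 ^ r)%N by rewrite ltn_expl.
by move: (2 ^ r)%N => m ltrm; lia.
Qed.
End Vdc.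

(** * Counting degenerate cubes *)

Section CubeCount.
Variables (V : finType) (add : V -> V -> V).

(** [us] lists the vertices of a cube as offsets from its base vertex; a new direction [h] adds the
    translated copy. *)
Definition double (us : seq V) (h : V) := us ++ [seq add h u | u <- us].

Fixpoint cube_count (bad : seq V -> nat) k (us : seq V) : nat :=
  if k is k'.+1 then (\sum_h cube_count bad k' (double us h))%N else bad us.
End CubeCount.

Section CubeSum.
Variables (F : finFieldType) (I : finType).
Local Notation Z := {ffun I -> F^o}.

Lemma eq_cubesum k (w1 w2 : Z -> int) : w1 =1 w2 -> cubesum k w1 = cubesum k w2.
Proof.
elim: k w1 w2 => [|k IH] w1 w2 eq_w /=.
  by congr `| _ |; apply: eq_bigr => z _.
by apply: eq_bigr => h _; apply: IH => z; rewrite !eq_w.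
Qed.

(** A cube on which [bad] is 0 sums to 0 over its base point [z]. On any other cube the sum has
    [#|{: Z}|] terms, each at most [c ^+ D] because of the [D] vertices, and [bad] is at least 1
    there. *)
Lemma cubesum_le (bad : seq Z -> nat) (w : Z -> int) (c : int) D :
    (forall z, `|w z| <= c) ->
    (forall us, size us = D -> head 0 us = 0 -> us != [::] ->
      bad us = 0%N -> \sum_(z : Z) \prod_(u <- us) w (z + u) = 0) ->
  forall k us, (size us * 2 ^ k)%N = D -> head 0 us = 0 -> us != [::] ->
  cubesum k (fun z => \prod_(u <- us) w (z + u)) <=
  #|{: Z}|%:R * c ^+ D * (cube_count (@GRing.add Z) bad k us)%:R.
Proof.
move=> wc w0; have c0 : 0 <= c by apply: le_trans (wc 0).
elim=> [|k IH] us szus hus nus /=.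
  case Ebad: (bad us) => [|b].
    by rewrite w0 ?normr0 ?mulr0 // -szus expn0 muln1.
  apply: le_trans (_ : #|{: Z}|%:R * c ^+ D * 1 <= _); last first.
    by rewrite ler_wpM2l ?mulr_ge0 ?exprn_ge0 // ler1n.
  rewrite mulr1 mulr_natl -sumr_const.
  apply: le_trans (ler_norm_sum _ _ _) _; apply: ler_sum => z _.
  rewrite -szus expn0 muln1; elim: (us) => [|u s IHs]; first by rewrite big_nil normr1.
  by rewrite big_cons normrM exprS ler_pM.
rewrite natr_sum mulr_sumr; apply: ler_sum => h _.
rewrite (@eq_cubesum _ _ (fun z => \prod_(u <- double (@GRing.add Z) us h) w (z + u))).
  apply: IH; first by rewrite size_cat size_map addnn -mul2n -szus expnS mulnA [(2 * _)%N]mulnC.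
    by case: us hus nus {szus}.
  by case: us nus {szus hus}.
by move=> z; rewrite big_cat big_map /=; under [X in _ = _ * X]eq_bigr do rewrite addrA.
Qed.
End CubeSum.

(** The factors for different [m] read different coordinates of the directions, so the sum over
    directions factors by distributivity; the coordinates in [J] are free. *)
Lemma cube_count_coord (F : finFieldType) (M : nat) (J : finType) (b : seq F -> nat) k
    (us : seq {ffun 'I_M + J -> F^o}) :
  cube_count (@GRing.add {ffun 'I_M + J -> F^o}) (fun us : seq {ffun 'I_M + J -> F^o} =>
    \prod_(m < M) b [seq u (inl m) | u : {ffun 'I_M + J -> F^o} <- us])%N k us =
  (#|F| ^ (#|J| * k) *
   \prod_(m < M) cube_count (@GRing.add F) b k [seq u (inl m) | u : {ffun 'I_M + J -> F^o} <- us])%N.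
Proof.
elim: k us => [|k IH] us /=; first by rewrite muln0 mul1n.
under eq_bigr do rewrite IH.
pose psi (i : 'I_M + J) (f : F) : nat :=
  if i is inl m then
    cube_count (@GRing.add F) b k (double (@GRing.add F) [seq u (inl m) | u : {ffun 'I_M + J -> F^o} <- us] f) else 1%N.
rewrite -big_distrr /= mulnS expnD -mulnA mulnCA; congr (_ * _)%N.
transitivity (\sum_(h : {ffun 'I_M + J -> F}) \prod_i psi i (h i))%N.
  apply: eq_bigr => h _; rewrite big_sumType /= [X in (_ * X)%N]big1 // muln1.
  apply: eq_bigr => m _; congr cube_count.
  rewrite /double map_cat -!map_comp; congr (_ ++ _).
  by apply: eq_map => u /=; rewrite ffunE.
rewrite -bigA_distr_bigA big_sumType /= mulnC; congr (_ * _)%N.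
by under eq_bigr do rewrite sum1_card; rewrite prod_nat_const.
Qed.

(** Applied to one coordinate of the offsets of a cube, this detects a collision of another vertex
    with the base vertex. *)
Definition zero_tail (F : finFieldType) (vs : seq F) : nat := 0 \in behead vs.

(** A direction [f] creates a new zero only if [f = - v] for one of the [size vs] entries [v]. The
    list doubles with each direction, so these exceptions add up to the factor [2 ^ k - 1]. *)
Lemma cube_count_zero (F : finFieldType) k (vs : seq F) : vs != [::] ->
  (#|F| * cube_count (@GRing.add F) (@zero_tail F) k vs <=
   #|F| ^ k.+1 * zero_tail vs + size vs * (2 ^ k - 1) * #|F| ^ k)%N.
Proof.
elim: k vs => [|k IH] vs nvs /=; first by rewrite expn1 subnn muln0 addn0.
rewrite big_distrr /=.
apply: leq_trans (_ : \sum_(f : F) (#|F| ^ k.+1 * (zero_tail vs + (f \in [seq - v | v <- vs])) +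
    (size vs).*2 * (2 ^ k - 1) * #|F| ^ k) <= _)%N.
  apply: leq_sum => f _; apply: leq_trans (IH _ _) _; first by case: vs nvs.
  rewrite size_cat size_map addnn leq_add2r leq_mul2l; apply/orP; right.
  rewrite /zero_tail /double; case: vs nvs => //= v vs _; rewrite mem_cat.
  case: (0%R \in vs) => //=; rewrite add0n.
  have -> : (0%R \in f + v :: [seq f + i | i <- vs]) = (f \in - v :: [seq - i | i <- vs]).
    rewrite -!map_cons; apply/mapP/mapP => -[u uin].
      by move=> /esym/eqP; rewrite addr_eq0 => /eqP ->; exists u.
    by move=> ->; exists u; rewrite // addNr.
  by [].
rewrite big_split /= -big_distrr /= big_split /= !sum_nat_const.
have le_s : (\sum_(f : F) (f \in [seq - v | v <- vs]) <= size vs)%N.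
  rewrite -(size_map -%R vs).
  apply: leq_trans (card_size _); rewrite -sum1_card [leqRHS]big_mkcond /=.
  by apply: leq_sum => i _; case: (i \in _).
rewrite expnS.
have := leq_mul (leqnn (#|F| ^ k.+1)%N) le_s; rewrite !expnS.
have: (0 < 2 ^ k)%N by rewrite expn_gt0.
set X := (\sum_i _)%N; move: (2 ^ k)%N (#|F| ^ k)%N (#|F|) (size vs) X => a b q s X.
case: (zero_tail vs) => [|?] /=; nia.
Qed.

(** Among all [r]-tuples of directions, a collision at one coordinate has frequency at most
    [2 ^ r / q], where [q] is the order of [F], and the [M] coordinates are independent. *)
Lemma cube_count_bound (F : finFieldType) (M r : nat) (J : finType) :
  (#|F| ^ M * cube_count (@GRing.add {ffun 'I_M + J -> F^o}) (fun us : seq {ffun 'I_M + J -> F^o} =>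
    \prod_(m < M) zero_tail [seq (u (inl m) : F) | u : {ffun 'I_M + J -> F^o} <- us])%N
     r [:: 0%R] <= 2 ^ (r * M) * #|{ffun 'I_M + J -> F}| ^ r)%N.
Proof.
rewrite cube_count_coord card_ffun card_sum card_ord.
rewrite mulnCA -{1}(card_ord M) -prod_nat_const -big_split /=.
apply: leq_trans (_ : #|F| ^ (#|J| * r) * \prod_(m < M) (2 ^ r * #|F| ^ r) <= _)%N.
  rewrite leq_mul2l; apply/orP; right; apply: leq_prod => m _.
  apply: leq_trans (cube_count_zero _ _) _ => //=; rewrite muln0 mul1n.
  by rewrite leq_mul2r leq_subr orbT.
rewrite prod_nat_const card_ord expnMn -!expnM mulnCA -expnD leq_mul2l.
apply/orP; right; rewrite leq_eqVlt; apply/orP; left; apply/eqP; congr expn.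
by rewrite mulnDl addnC [(r * M)%N]mulnC.
Qed.

(** * The hash of a slope and its behaviour on cubes *)

Section Hash.
Variables (F : finFieldType) (M r D : nat).
Local Notation I := ('I_M + 'I_r * 'I_M * 'I_D)%type.
Local Notation Z := {ffun I -> F^o}.
Local Notation q := #|F|.

(* The coordinates of z are the points z (inl m) and, for every l, the
   coefficients of M polynomials; the independent points make a collision at all
   of them unlikely. *)
Definition hash (z : Z) : {ffun 'I_r -> F} :=
  [ffun l => \sum_(m < M) \sum_(k < D) (z (inr (l, m, k)) : F) * (z (inl m) : F) ^+ k].

Definition balanced (t : {ffun 'I_r -> F}) (z : Z) : int :=
  q%:R ^+ r * (hash z == t)%:R - 1.

Lemma balanced_bound t z : `|balanced t z| <= q%:R ^+ r.
Proof.
have q1 : 1 <= (q%:R : int) ^+ r.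
  by rewrite -natrX ler1n expn_gt0 (cardD1 0).
rewrite /balanced; case: (_ == _); last by rewrite mulr0 add0r normrN1.
by rewrite mulr1 ger0_norm ?subr_ge0 // gerBl.
Qed.

(** Adding this to [z] adds [c l * p] to the [m]-th polynomial of the [l]-th hash coordinate and
    keeps all evaluation points. *)
Definition hash_shift (m : 'I_M) (p : {poly F}) (c : {ffun 'I_r -> F}) : Z :=
  [ffun i : I => match i return F^o with
             | inl _ => 0
             | inr (l, m', k) => if m' == m then c l * p`_k else 0
             end].

Lemma hash_shiftE m (p : {poly F}) c (z : Z) : (size p <= D)%N ->
  hash (z + hash_shift m p c) = [ffun l => hash z l + c l * p.[z (inl m) : F]].
Proof.
move=> szp; apply/ffunP => l; rewrite !ffunE.
transitivity (\sum_(m' < M) \sum_(k < D) ((z (inr (l, m', k)) : F) * (z (inl m') : F) ^+ k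
   + (if m' == m then c l * p`_k * (z (inl m) : F) ^+ k else 0))).
  apply: eq_bigr => m' _; apply: eq_bigr => k _; rewrite !ffunE addr0 mulrDl.
  by case: eqP => [->|]; rewrite ?mul0r.
under eq_bigr do rewrite big_split; rewrite big_split /=; congr (_ + _).
rewrite (bigD1 m) //= eqxx [X in _ + X]big1 ?addr0; last first.
  by move=> m' /negPf ->; rewrite big1.
rewrite (horner_coef_wide _ szp) mulr_sumr.
by apply: eq_bigr => k _; rewrite mulrA.
Qed.

(** As [p] does not vanish at the [m]-th point, exactly one [c] brings the hash to [t]. Its
    contribution [q ^ r] cancels the [q ^ r] terms [- 1]. *)
Lemma balanced_sum0 t (z : Z) m (p : {poly F}) : (size p <= D)%N -> p.[z (inl m) : F] != 0 ->
  \sum_(c : {ffun 'I_r -> F}) balanced t (z + hash_shift m p c) = 0.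
Proof.
move=> szp pz; rewrite /balanced sumrB sumr_const card_ffun card_ord -mulr_sumr.
rewrite (bigD1 [ffun l => (t l - hash z l) / p.[z (inl m) : F]]) //=.
rewrite hash_shiftE //.
have -> : [ffun l => hash z l + [ffun l0 => (t l0 - hash z l0) / p.[z (inl m) : F]] l
     * p.[z (inl m) : F]] = t.
  by apply/ffunP => l; rewrite ffunE [X in _ + X * _]ffunE mulfVK // addrC subrK.
rewrite eqxx big1 ?addr0 ?mulr1 ?natrX ?subrr // => c nc.
rewrite hash_shiftE //; case: eqP => // eqt; case/eqP: nc; apply/ffunP => l.
rewrite -eqt.
by rewrite !ffunE [_ + c l * _]addrC addrK mulfK.
Qed.

(* Translating z along its coefficients by multiples of a polynomial that vanishes
   at all points of the cube but one changes the hash at that vertex only. *)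
Lemma balanced_cube0 t (us : seq Z) m : size us = D -> head 0 us = 0 -> us != [::] ->
  zero_tail [seq (u (inl m) : F) | u : Z <- us] = 0%N ->
  \sum_(z : Z) \prod_(u <- us) balanced t (z + u) = 0.
Proof.
case: us => //= u us szus -> {u} _; rewrite /zero_tail /= => /eqP; rewrite eqb0 => us0.
(* With [c] the [m]-th point of the base vertex, the roots of [P c] are the [m]-th points of the
   other vertices. *)
pose P (c : F) := \prod_(u <- us) ('X - ((c + (u : Z) (inl m) : F))%:P).
have szP c : (size (P c) <= D)%N by rewrite size_prod_XsubC szus.
(* For fixed [c] the shift depends on [z] only through its [m]-th point, which it preserves; hence
   it is injective. *)
pose s c (z : Z) := z + hash_shift m (P (z (inl m))) c.
have sm c z : s c z (inl m) = z (inl m) by rewrite /s !ffunE addr0.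
have s_inj c : injective (s c).
  move=> z1 z2 eqs; have := sm c z1; rewrite eqs sm => eqm.
  by move: eqs; rewrite /s eqm => /addIr.
pose G (z : Z) := \prod_(u <- 0 :: us) balanced t (z + u).
(* Each [s c] permutes the summands, so this is [q ^ r] copies of the wanted sum. For fixed [z] only
   the factor at the base vertex depends on [c], and that factor sums to 0. *)
have /eqP : \sum_(c : {ffun 'I_r -> F}) \sum_z G z = 0.
  under eq_bigr => c _ do rewrite (reindex_inj (@s_inj c)) /=.
  rewrite exchange_big big1 // => z _ /=.
  transitivity (\sum_(c : {ffun 'I_r -> F}) balanced t (z + hash_shift m (P (z (inl m))) c) *
     \prod_(u <- us) balanced t (z + u)).
    apply: eq_bigr => c _; rewrite /G big_cons addr0; congr (_ * _).
    apply: eq_big_seq => u uin; rewrite /balanced /s addrAC hash_shiftE //.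
    congr (_ * (_ == _)%:R - _); apply/ffunP => l; rewrite ffunE.
    have -> : (P (z (inl m))).[(z + u) (inl m) : F] = 0; last by rewrite mulr0 addr0.
    rewrite /P horner_prod (big_rem u) //= ffunE !hornerE subrr ?mul0r //.
  rewrite -mulr_suml balanced_sum0 ?mul0r // /P horner_prod prodf_seq_neq0.
  apply/allP => u uin /=; rewrite !hornerE opprD addrA subrr sub0r oppr_eq0.
  by apply: contra us0 => /eqP <-; apply: map_f.
rewrite sumr_const card_ffun card_ord mulrn_eq0 expn_eq0 (cardD1 0) /=.
by move=> /eqP.
Qed.

End Hash.

(** Bounds the tuples of abscissas with a repetition, at most a fraction [r ^ 2 / q] of all, which
    are not covered by the estimate for injective tuples. *)
Lemma ffact_lower q r : (q * q ^ r <= q * q ^_ r + r ^ 2 * q ^ r)%N.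
Proof.
elim: r => [|r IH]; first by rewrite ffactn0 expn0 leq_addr.
rewrite ffactnSr; case: (leqP r q) => [le_rq|lt_qr].
  have le_ff : (q ^_ r <= q ^ r)%N.
    elim: r {IH le_rq} => // r IHr; rewrite ffactnSr expnSr leq_mul ?leq_subr //.
  rewrite expnSr !mulnA.
  have := leq_mul IH (leqnn q).
  move: (q ^ r)%N (q ^_ r)%N le_ff => a b; nia.
apply: leq_trans (leq_addl _ _); rewrite leq_mul2r; apply/orP; right.
by rewrite -mulnn; nia.
Qed.

(** * Density of sets without edges *)

Section LineSystem.
Variables (F : finFieldType) (r : nat).
Local Notation M := (r.+1 * 2 ^ r)%N.
Local Notation I := ('I_M + 'I_r * 'I_M * 'I_(2 ^ r))%type.
Local Notation Z := {ffun I -> F^o}.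
Local Notation q := #|F|.
Local Notation N := #|{: Z}|.
Variable A : {set F * Z}.

Definition line_hits (t : {ffun 'I_r -> F}) : nat :=
  (\sum_(x : Z) \sum_(z : Z) \prod_(l < r) ((t l, (x + t l *: z)%R) \in A))%N.

Definition no_line_edge := forall x z : Z, injective (hash z : {ffun 'I_r -> F}) ->
  exists l : 'I_r, (hash z l, x + hash z l *: z) \notin A.

Hypothesis A_free : no_line_edge.

(** Only cubes with collisions at all [M] points survive in the cube sum. They are a fraction at
    most [(2 ^ r / q) ^ M], while the bound [q ^ r] on the weight costs [q ^ (r * 2 ^ r)]. With
    [M = r.+1 * 2 ^ r] a saving of [q ^ (2 ^ r)] remains, whose [2 ^ r]-th root is the factor
    [q]. *)
Lemma line_hits_inj (t : {ffun 'I_r -> F}) : injective t -> (q * line_hits t <= 2 ^ (r * r.+1) * N ^ 2)%N.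
Proof.
move=> t_inj.
(* [t] is extended to all natural indices with the default value 0. *)
pose tn i := oapp (fun l => t l) (0 : F) (insub i).
pose g i (u : Z) : int := ((tn i, u) \in A)%:R.
pose w := balanced t : Z -> int.
have tnE (l : 'I_r) : tn l = t l by rewrite /tn valK.
have S_E : \sum_(x : Z) \sum_(z : Z) (\prod_(i < r) g i (x + tn i *: z)) * w z =
    - (line_hits t)%:R.
  rewrite natr_sum -sumrN; apply: eq_bigr => x _.
  rewrite natr_sum -sumrN; apply: eq_bigr => z _.
  rewrite natr_prod (eq_bigr (fun l : 'I_r => ((t l, x + t l *: z) \in A)%:R)); last first.
    by move=> l _; rewrite /g tnE.
  (* Where the hash equals [t], the hypothesis on [A] puts a factor 0 into the product; elsewhere
     the weight is [- 1]. *)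
  rewrite /w /balanced; case: eqP => [ht|_]; last by rewrite mulr0 sub0r mulrN1.
  have [|l] := A_free x (z := z); first by rewrite ht.
  by rewrite ht => /negPf Al; rewrite (bigD1 l) //= Al !mul0r oppr0.
have := @van_der_corput F I r tn g w; rewrite S_E normrN normr_nat => /(_ _).
have g1 i u : `|g i u| <= 1 by rewrite /g normr_nat lern1; case: (_ \in _).
move=> /(_ g1) vdc.
pose bad := (fun us : seq Z => \prod_(m < M) zero_tail [seq (u (inl m) : F) | u : Z <- us])%N.
have cs : cubesum r w <= N%:R * (q%:R ^+ r) ^+ (2 ^ r) *
    (cube_count (@GRing.add Z) bad r [:: 0])%:R.
  rewrite (@eq_cubesum _ _ _ _ (fun z => \prod_(u <- [:: 0]) w (z + u))); last first.
    by move=> z; rewrite big_seq1 addr0.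
  apply: cubesum_le; rewrite ?mul1n //; first exact: balanced_bound.
  move=> us szus hus nus /eqP; rewrite /bad prod_nat_seq_eq0.
  by case/hasP=> m _ /eqP; exact: balanced_cube0.
have cb := cube_count_bound F M r ('I_r * 'I_M * 'I_(2 ^ r))%type.
have e0 : (0 < 2 ^ r)%N by rewrite expn_gt0.
have q0 : (0 < q)%N by rewrite (cardD1 0).
have le1 : (line_hits t ^ 2 ^ r <= N ^ (2 * 2 ^ r - 1 - r) * (N * (q ^ r) ^ 2 ^ r *
    cube_count (@GRing.add Z) bad r [:: 0%R]))%N.
  rewrite -(ler_nat int) !natrM !natrX.
  by apply: le_trans vdc _; rewrite ler_wpM2l ?exprn_ge0.
have Er : (2 * 2 ^ r - 1 - r + r.+1 = 2 * 2 ^ r)%N.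
  by have := ltn_expl r (ltnSn 1); move: (2 ^ r)%N => m; lia.
rewrite -(leq_exp2r _ _ e0) -(@leq_pmul2l ((q ^ r) ^ 2 ^ r)%N) ?expn_gt0 ?q0 //.
have -> : ((q ^ r) ^ 2 ^ r * (q * line_hits t) ^ 2 ^ r = q ^ M * line_hits t ^ 2 ^ r)%N.
  by rewrite expnMn mulnA -expnMn -expnSr -expnM.
apply: leq_trans (leq_mul (leqnn _) le1) _.
have -> : ((q ^ r) ^ 2 ^ r * (2 ^ (r * r.+1) * N ^ 2) ^ 2 ^ r =
  N ^ (2 * 2 ^ r - 1 - r) * (N * (q ^ r) ^ 2 ^ r * (2 ^ (r * M) * N ^ r)))%N.
  have -> : ((2 ^ (r * r.+1) * N ^ 2) ^ 2 ^ r =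
      2 ^ (r * M) * (N ^ (2 * 2 ^ r - 1 - r) * (N ^ r * N)))%N.
    by rewrite -[(N ^ r * N)%N]expnSr -expnD Er expnMn -!expnM [(r * (_ * _))%N]mulnA.
  by move: (N ^ _)%N (N ^ r)%N (2 ^ (_ * M))%N (_ ^ _ ^ _)%N => a b c d; ring.
rewrite [(q ^ M * (_ * _))%N]mulnCA leq_mul2l; apply/orP; right.
by rewrite [(q ^ M * (_ * _))%N]mulnCA leq_mul2l; apply/orP; right.
Qed.

(** Distributivity: the [r]-th power of the number of points of [A] on a line counts the [r]-tuples
    of abscissas of such points. *)
Lemma power_sum_hits : (\sum_(x : Z) \sum_(z : Z)
   (\sum_(tau : F) ((tau, (x + tau *: z)%R) \in A)) ^ r = \sum_(t : {ffun 'I_r -> F}) line_hits t)%N.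
Proof.
rewrite /line_hits [RHS]exchange_big; apply: eq_bigr => x _ /=.
rewrite [RHS]exchange_big; apply: eq_bigr => z _ /=.
by rewrite -(bigA_distr_bigA (fun _ tau => ((tau, (x + tau *: z)%R) \in A) : nat)) prod_nat_const card_ord.
Qed.

(** Every vertex lies on exactly one line of each slope. *)
Lemma sum_hits : (\sum_(x : Z) \sum_(z : Z) \sum_(tau : F) ((tau, (x + tau *: z)%R) \in A)
   = #|A| * N)%N.
Proof.
rewrite exchange_big /= [RHS]mulnC -[RHS]sum_nat_const; apply: eq_bigr => z _.
transitivity (\sum_(tau : F) \sum_(u : Z) ((tau, u) \in A))%N.
  rewrite exchange_big /=; apply: eq_bigr => tau _.
  rewrite (reindex_inj (addIr (- (tau *: z)))) /=.
  by apply: eq_bigr => u _; rewrite subrK.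
rewrite pair_bigA /= -sum1_card [RHS]big_mkcond /=.
by apply: eq_bigr => -[tau u] _ /=; case: (_ \in _).
Qed.

Lemma sum_line_hits : (q * \sum_(t : {ffun 'I_r -> F}) line_hits t <=
   (2 ^ (r * r.+1) + r ^ 2) * (q ^ r * N ^ 2))%N.
Proof.
rewrite (bigID (fun t : {ffun 'I_r -> F} => injectiveb t)) /= mulnDr mulnDl.
have card_inj : #|[pred t : {ffun 'I_r -> F} | injectiveb t]| = (q ^_ r)%N.
  have := card_inj_ffuns 'I_r F; rewrite card_ord => <-.
  by apply: eq_card => t; rewrite !inE.
have hits_le t : (line_hits t <= N ^ 2)%N.
  rewrite /line_hits -mulnn -sum_nat_const leq_sum // => x _.
  rewrite -[leqRHS]muln1 -sum_nat_const leq_sum // => z _.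
  by rewrite -[leqRHS](exp1n r) -[in leqRHS](card_ord r) -prod_nat_const leq_prod // => l _; case: (_ \in _).
apply: leq_add.
  rewrite big_distrr /=; apply: leq_trans (_ : \sum_(t : {ffun 'I_r -> F}) 2 ^ (r * r.+1) * N ^ 2 <= _)%N.
    rewrite big_mkcond; apply: leq_sum => t _; case: injectiveP => // /line_hits_inj; exact.
  by rewrite sum_nat_const card_ffun card_ord mulnCA.
apply: leq_trans (_ : q * ((q ^ r - q ^_ r) * N ^ 2) <= _)%N.
  rewrite leq_mul2l; apply/orP; right.
  have -> : (q ^ r - q ^_ r)%N = #|[pred t : {ffun 'I_r -> F} | ~~ injectiveb t]|.
    have := cardC [pred t : {ffun 'I_r -> F} | injectiveb t].
    by rewrite card_ffun card_ord card_inj => <-; rewrite addKn; apply: eq_card.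
  by rewrite -sum_nat_const leq_sum.
rewrite !mulnA; do 2!apply: leq_mul => //; have := ffact_lower q r.
by rewrite mulnBr leq_subLR.
Qed.

(** The power mean runs over the [N ^ 2] lines, which contain [#|A| / N] points of [A] on
    average. *)
Lemma no_line_edge_card : (0 < r)%N ->
  (q * #|A| ^ r <= (2 ^ (r * r.+1) + r ^ 2) * (q * N) ^ r)%N.
Proof.
move=> r0; have N0 : (0 < N)%N by rewrite card_ffun expn_gt0 (cardD1 0).
have pm := @power_mean int _
  (fun p : Z * Z => (\sum_(tau : F) ((tau, (p.1 + tau *: p.2)%R) \in A))%N%:R) r.-1 (fun=> ler0n _ _).
have {pm} : ((#|A| * N) ^ r <= (N ^ 2) ^ r.-1 * \sum_(t : {ffun 'I_r -> F}) line_hits t)%N.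
  rewrite -sum_hits -power_sum_hits
    (pair_bigA _ (fun x z : Z => \sum_(tau : F) ((tau, (x + tau *: z)%R) \in A))%N)
    (pair_bigA _ (fun x z : Z => (\sum_(tau : F) ((tau, (x + tau *: z)%R) \in A)) ^ r)%N).
  move: pm; rewrite prednK // -natr_sum card_prod mulnn.
  have -> : \sum_(p : Z * Z) (\sum_(tau : F) ((tau, (p.1 + tau *: p.2)%R) \in A))%N%:R ^+ r =
     (\sum_(p : Z * Z) (\sum_(tau : F) ((tau, (p.1 + tau *: p.2)%R) \in A)) ^ r)%N%:R :> int.
    by rewrite natr_sum; apply: eq_bigr => p _; rewrite natrX.
  by rewrite -!natrX -natrM ler_nat.
move/(leq_mul (leqnn q)); rewrite [leqRHS]mulnCA => le1.
have := leq_trans le1 (leq_mul (leqnn _) sum_line_hits).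
have -> : forall n c, ((n ^ 2) ^ r.-1 * (c * (q ^ r * n ^ 2)) = c * (q * n) ^ r * n ^ r)%N.
  move=> n c; case: (r) r0 => // k _ /=; rewrite -!mulnn !expnMn !expnS.
  by move: (n ^ _)%N (q ^ _)%N => a b; ring.
by rewrite expnMn mulnA leq_pmul2r ?expn_gt0 ?N0.
Qed.
End LineSystem.

Local Close Scope ring_scope.

(** * Primes *)

Lemma central_bin_lower m : 2 ^ m <= 'C(2 * m, m).
Proof.
elim: m => // m IH; rewrite -(leq_pmul2l (ltn0Sn m)).
have -> : 2 * m.+1 = (2 * m).+2 by rewrite !mul2n doubleS.
rewrite -mul_bin_diag /= expnS.
have -> : (2 * m).+2 = m.+1 * 2 by lia.
rewrite -mulnA leq_mul2l /= leq_mul2l /=; apply: leq_trans IH _.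
by case: m => // m; rewrite [X in _ <= X]binS leq_addr.
Qed.

(** By Legendre's formula the exponent is the sum over [k] of [2 * m %/ p ^ k] minus twice
    [m %/ p ^ k]; each term is at most 1 and vanishes once [p ^ k] exceeds [2 * m]. *)
Lemma logn_central_bin p m : prime p -> 0 < m -> p ^ logn p 'C(2 * m, m) <= 2 * m.
Proof.
move=> p_pr m0; have p1 := prime_gt1 p_pr.
apply: leq_trans (trunc_logP p1 (_ : 0 < 2 * m)); last by rewrite muln_gt0.
rewrite leq_pexp2l ?prime_gt0 //.
have le_m2 : m <= 2 * m by rewrite leq_pmull.
have := bin_fact le_m2; have -> : 2 * m - m = m by lia.
move/(congr1 (logn p)); rewrite !lognM ?muln_gt0 ?fact_gt0 ?bin_gt0 // !logn_fact //.
have ext : \sum_(1 <= k < m.+1) m %/ p ^ k = \sum_(1 <= k < (2 * m).+1) m %/ p ^ k.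
  rewrite [RHS](@big_cat_nat _ _ _ m.+1) ?ltnS ?leq_pmull //= [X in _ = _ + X]big_nat_cond [X in _ = _ + X]big1 ?addn0 //.
  move=> k /andP[/andP[ltmk _] _]; rewrite divn_small //.
  by apply: leq_trans (ltn_expl k p1); exact: ltnW.
rewrite ext => eq_sum; rewrite -(leq_add2r (\sum_(1 <= k < (2 * m).+1) m %/ p ^ k + \sum_(1 <= k < (2 * m).+1) m %/ p ^ k)).
rewrite eq_sum; set t := trunc_log p (2 * m).
have -> : t = \sum_(1 <= k < (2 * m).+1) (k <= t).
  have t2m : t < (2 * m).+1.
    rewrite ltnS; apply: leq_trans (trunc_logP p1 (_ : 0 < 2 * m)); last by rewrite muln_gt0.
    by apply: ltnW; rewrite ltn_expl.
  rewrite (@big_cat_nat _ _ _ t.+1) //= big_nat [X in _ + X]big_nat.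
  rewrite (eq_bigr (fun=> 1)) => [|k /andP[_]]; last by rewrite ltnS => ->.
  rewrite -big_nat sum_nat_const_nat [X in _ + X]big1 ?addn0 ?muln1 ?subn1 // => k /andP[ltk _].
  by rewrite leqNgt ltk.
rewrite -!big_split /=; apply: leq_sum => k _.
case: (leqP k t) => [_|lt_tk]; first by rewrite mul2n -addnn addnC addn1 -addn1 leq_divDl.
rewrite divn_small //; apply: leq_trans (trunc_log_ltn _ p1) _.
by rewrite leq_pexp2l // prime_gt0.
Qed.

(* The prime powers in 'C(2 * m, m) are at most 2 * m, whence
   2 ^ m <= 'C(2 * m, m) <= (2 * m) ^ p for its largest prime divisor p. *)
Lemma prime_interval m : 0 < m -> exists p, [/\ prime p, p <= 2 * m & m < 9 * p ^ 2].
Proof.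
move=> m0; set C := 'C(2 * m, m).
have C0 : 0 < C by rewrite bin_gt0 leq_pmull.
have C1 : 1 < C.
  by apply: leq_trans (central_bin_lower m); rewrite -[1](expn0 2) ltn_exp2l.
pose p := max_pdiv C; have p_pr : prime p by exact: max_pdiv_prime.
exists p; split => //.
  apply: leq_trans (logn_central_bin p_pr m0).
  rewrite -[X in X <= _]expn1 leq_exp2l ?prime_gt1 // logn_gt0 mem_primes p_pr C0.
  exact: max_pdiv_dvd.
have C_le : C <= (2 * m) ^ p.
  rewrite [X in X <= _](prod_prime_decomp C0) prime_decompE big_map /=.
  apply: leq_trans (_ : \prod_(i <- primes C) (2 * m) <= _).
    rewrite big_seq [X in _ <= X]big_seq; apply: leq_prod => i.
    by rewrite mem_primes => /and3P[i_pr _ _]; exact: logn_central_bin.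
  rewrite big_const_seq count_predT iter_muln_1 leq_pexp2l ?muln_gt0 //.
  rewrite -(size_iota 1 p); apply: uniq_leq_size (primes_uniq _) _ => i ip.
  rewrite mem_iota add1n ltnS max_pdiv_max // andbT.
  by move: ip; rewrite mem_primes => /andP[/prime_gt0].
(* The integer square root of [m]. As [m < s.+1 ^ 2 <= 2 ^ (2 * s)], the inequality
   [2 ^ m <= (2 * m) ^ p] gives [s ^ 2 <= m < (2 * s).+1 * p], hence [s < 3 * p]. *)
pose s := \max_(i < m.+1 | i ^ 2 <= m) i.
have [i0 i0m sE] : {i : 'I_m.+1 | i ^ 2 <= m & s = i}.
  by apply: (@eq_bigmax_cond _ _ (fun i : 'I_m.+1 => i : nat)); apply/card_gt0P; exists ord0.
have s2 : s ^ 2 <= m by rewrite sE.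
have ltm : m < s.+1 ^ 2.
  rewrite ltnNge; apply/negP => le_m.
  have lts : s.+1 < m.+1 by rewrite ltnS; apply: leq_trans le_m; rewrite -mulnn leq_pmulr.
  by have := @leq_bigmax_cond _ (fun i : 'I_m.+1 => i ^ 2 <= m) (fun i : 'I_m.+1 => i : nat) (Ordinal lts) le_m; rewrite -/s ltnn.
have s0 : 0 < s by case: (s) ltm => //; rewrite ltnS leqn0 => /eqP m_0; rewrite m_0 in m0.
have lt2m : 2 * m < 2 ^ (2 * s).+1.
  rewrite expnS ltn_mul2l /=; apply: leq_trans ltm _.
  by rewrite mulnC expnM leq_exp2r // ltn_expl.
have : 2 ^ m < 2 ^ ((2 * s).+1 * p).
  apply: leq_ltn_trans (central_bin_lower m) _; apply: leq_ltn_trans C_le _.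
  by rewrite expnM ltn_exp2r // prime_gt0.
rewrite ltn_exp2l // => ltmp.
have : s < 3 * p by nia.
nia.
Qed.

(** * Polynomial time programs *)

Section Programs.

Notation env := (nat -> nat).

Definition agree b (rho rho' : env) := forall x, x < b -> rho x = rho' x.

Definition reads_below b (T : Type) (f : env -> T) := forall rho rho',
  agree b rho rho' -> f rho = f rho'.

Definition ready (st : state) := reg st 1 = 1 /\ reg st 2 = 0.

(** The base [(reg st 0).+1] is positive, so that bounds with different exponents can be added when
    programs are composed. *)
Definition run_to p c k (st st' : state) :=
  exists2 t, exec p st t st' & t <= c * (reg st 0).+1 ^ k.

(* Code for f can be placed above any number b' >= b of registers in use, hence
   inside further loops; registers 0, 1 and 2 hold n, 1 and 0. *)
Definition computes b (f : env -> nat) := reads_below b f /\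
  forall b', 2 < b' -> b <= b' -> exists p c k, forall st, ready st ->
    exists st', [/\ run_to p c k st st', reg st' b' = f (reg st),
                    agree b' (reg st') (reg st) & out st' = out st].

Definition outputs b (w : env -> seq nat) := reads_below b w /\
  forall b', 2 < b' -> b <= b' -> exists p c k, forall st, ready st ->
    exists st', [/\ run_to p c k st st',
                    agree b' (reg st') (reg st) & out st' = out st ++ w (reg st)].

Lemma agreeW b b' rho rho' : b <= b' -> agree b' rho rho' -> agree b rho rho'.
Proof. by move=> le_b ag x ltx; apply: ag; apply: leq_trans le_b. Qed.

Lemma agree_trans b rho1 rho2 rho3 :
  agree b rho1 rho2 -> agree b rho2 rho3 -> agree b rho1 rho3.
Proof. by move=> a1 a2 x ltx; rewrite a1 // a2. Qed.

Lemma agree_sym b rho rho' : agree b rho rho' -> agree b rho' rho.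
Proof. by move=> a x ltx; rewrite a. Qed.

Lemma agree_upd b x v rho : b <= x -> agree b (upd rho x v) rho.
Proof. by move=> le_b y lty; rewrite /upd; case: eqP => // ?; lia. Qed.

Lemma updE rho x v : upd rho x v x = v.
Proof. by rewrite /upd eqxx. Qed.

Lemma upd_neq rho x y v : y <> x -> upd rho x v y = rho y.
Proof. by rewrite /upd; case: eqP. Qed.

Lemma agree_ready b st st' : 2 < b -> agree b (reg st') (reg st) -> ready st -> ready st'.
Proof. by move=> b2 ag [r1 r2]; split; rewrite ag //; lia. Qed.

Lemma reads_belowW b b' T (f : env -> T) : b <= b' -> reads_below b f -> reads_below b' f.
Proof. by move=> le_b lf rho rho' ag; apply: lf; apply: agreeW ag. Qed.

Lemma computesW b b' f : b <= b' -> computes b f -> computes b' f.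
Proof.
move=> le_b [lf ef]; split; first exact: reads_belowW lf.
by move=> b'' b''2 le_b'; apply: ef => //; apply: leq_trans le_b'.
Qed.

Lemma eq_computes b f g : f =1 g -> computes b f -> computes b g.
Proof.
move=> fg [lf ef]; split=> [rho rho' ag|b' b'2 le_b].
  by rewrite -!fg; apply: lf.
have [p [c [k pP]]] := ef b' b'2 le_b; exists p, c, k => st /pP[st' []].
by rewrite fg; exists st'.
Qed.

Lemma eq_outputs b f g : f =1 g -> outputs b f -> outputs b g.
Proof.
move=> fg [lf ef]; split=> [rho rho' ag|b' b'2 le_b].
  by rewrite -!fg; apply: lf.
have [p [c [k pP]]] := ef b' b'2 le_b; exists p, c, k => st /pP[st' []].
by rewrite fg; exists st'.
Qed.

Lemma run_const p c st st' : exec p st c st' -> run_to p c 0 st st'.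
Proof. by exists c; rewrite // expn0 muln1. Qed.

Lemma run_seq p1 c1 k1 p2 c2 k2 st1 st2 st3 : reg st2 0 = reg st1 0 ->
  run_to p1 c1 k1 st1 st2 -> run_to p2 c2 k2 st2 st3 ->
  run_to (Seq p1 p2) (c1 + c2) (k1 + k2) st1 st3.
Proof.
move=> eq0 [t1 e1 le1] [t2 e2 le2]; exists (t1 + t2); first exact: ExecSeq e1 e2.
rewrite eq0 in le2; rewrite mulnDl leq_add //.
  by apply: leq_trans le1 _; rewrite leq_mul2l leq_pexp2l ?leq_addr ?orbT.
by apply: leq_trans le2 _; rewrite leq_mul2l leq_pexp2l ?leq_addl ?orbT.
Qed.

Lemma run_if x p1 c1 k1 p2 c2 k2 st st' :
  run_to (if reg st x != 0 then p1 else p2)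
    (if reg st x != 0 then c1 else c2) (if reg st x != 0 then k1 else k2) st st' ->
  run_to (If x p1 p2) (c1 + c2).+1 (k1 + k2) st st'.
Proof.
set n := (reg st 0).+1.
have le1 : c1 * n ^ k1 < (c1 + c2).+1 * n ^ (k1 + k2).
  apply: leq_ltn_trans (_ : c1 * n ^ (k1 + k2) < _).
    by rewrite leq_mul2l leq_pexp2l ?leq_addr ?orbT.
  by rewrite ltn_mul2r expn_gt0 ltnS leq_addr.
have le2 : c2 * n ^ k2 < (c1 + c2).+1 * n ^ (k1 + k2).
  apply: leq_ltn_trans (_ : c2 * n ^ (k1 + k2) < _).
    by rewrite leq_mul2l leq_pexp2l ?leq_addl ?orbT.
  by rewrite ltn_mul2r expn_gt0 ltnS leq_addl.
case: ifP => [nz|/eqP z] [t et let_].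
  by exists t.+1; [exact: ExecIfTrue|exact: leq_ltn_trans let_ _].
by exists t.+1; [exact: ExecIfFalse|exact: leq_ltn_trans let_ _].
Qed.

Lemma computes_reg b x : x < b -> computes b (fun rho => rho x).
Proof.
move=> ltx; split=> [rho rho' ag|b' b'2 le_b]; first exact: ag.
(* Register 2 holds 0, so this addition copies a register. *)
exists (Add b' x 2), 1, 0 => st [_ r2].
exists (set_reg st b' (reg st x + reg st 2)); split => //.
- by apply: run_const; exact: ExecAdd.
- by rewrite /= updE r2 addn0.
- exact: agree_upd.
Qed.

Lemma computes_const b v : computes b (fun=> v).
Proof.
split=> // b' b'2 le_b; exists (Const b' v), 1, 0 => st _.
exists (set_reg st b' v); split => //.
- by apply: run_const; exact: ExecConst.
- by rewrite /= updE.
- exact: agree_upd.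
Qed.

Lemma computes_bin (op : nat -> nat -> nat) (P : nat -> nat -> nat -> prog) b f g :
  (forall st x y z, exec (P x y z) st 1 (set_reg st x (op (reg st y) (reg st z)))) ->
  computes b f -> computes b g -> computes b (fun rho => op (f rho) (g rho)).
Proof.
move=> execP [lf ef] [lg eg]; split=> [rho rho' ag|b' b'2 le_b].
  by rewrite (lf _ rho') // (lg _ rho').
have [p1 [c1 [k1 pP1]]] := ef b' b'2 le_b.
(* The second operand goes to the next register, which leaves the first result in [b'] intact. *)
have [p2 [c2 [k2 pP2]]] := eg b'.+1 (ltnW b'2) (leqW le_b).
exists (Seq p1 (Seq p2 (P b' b' b'.+1))), (c1 + (c2 + 1)), (k1 + (k2 + 0)) => st rst.
have [st1 [run1 v1 ag1 out1]] := pP1 st rst.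
have rst1 := agree_ready b'2 ag1 rst.
have [st2 [run2 v2 ag2 out2]] := pP2 st1 rst1.
exists (set_reg st2 b' (op (reg st2 b') (reg st2 b'.+1))); split => //=.
- apply: run_seq run1 _; first by rewrite ag1 //; lia.
  apply: run_seq run2 _; first by rewrite ag2 //; lia.
  exact: run_const.
- rewrite updE ag2 // v1 v2; congr op.
  by apply: lg; apply: agreeW ag1.
- apply: agree_trans (agree_upd _ _ (leqnn _)) _.
  by apply: agree_trans ag1; apply: agreeW ag2.
- by rewrite out2.
Qed.

Lemma computes_if b f g h : computes b f -> computes b g -> computes b h ->
  computes b (fun rho => if f rho != 0 then g rho else h rho).
Proof.
move=> [lf ef] [lg eg] [lh eh]; split=> [rho rho' ag|b' b'2 le_b].
  by rewrite (lf _ rho') // (lg _ rho') // (lh _ rho').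
have [p1 [c1 [k1 pP1]]] := ef b' b'2 le_b.
have [p2 [c2 [k2 pP2]]] := eg b' b'2 le_b.
have [p3 [c3 [k3 pP3]]] := eh b' b'2 le_b.
exists (Seq p1 (If b' p2 p3)), (c1 + (c2 + c3).+1), (k1 + (k2 + k3)) => st rst.
have [st1 [run1 v1 ag1 out1]] := pP1 st rst.
have rst1 := agree_ready b'2 ag1 rst.
have [st2 [run2 v2 ag2 out2]] : exists st2, [/\
    run_to (if reg st1 b' != 0 then p2 else p3) (if reg st1 b' != 0 then c2 else c3)
      (if reg st1 b' != 0 then k2 else k3) st1 st2,
    reg st2 b' = (if f (reg st) != 0 then g (reg st) else h (reg st)),
    agree b' (reg st2) (reg st1) & out st2 = out st1].
  rewrite v1; case: ifP => _.
    rewrite (lg _ (reg st1)); first exact: pP2.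
    by apply: agree_sym; apply: agreeW ag1.
  rewrite (lh _ (reg st1)); first exact: pP3.
  by apply: agree_sym; apply: agreeW ag1.
exists st2; split => //; last by rewrite out2.
  by apply: run_seq run1 _; [rewrite ag1 //; lia|exact: run_if].
exact: agree_trans ag1.
Qed.

(** [Inv i] describes the state with [i] rounds left. The counter is decremented before [p] runs, so
    [p] sees the index [i]. Each round costs 2 more than [p], for the test and the subtraction. *)
Lemma exec_countdown x p T (Inv : nat -> state -> Prop) :
    (forall i st, Inv i.+1 st -> [/\ reg st x = i.+1, reg st 1 = 1 &
       exists t st', [/\ exec p (set_reg st x i) t st', t <= T & Inv i st']]) ->
    (forall st, Inv 0 st -> reg st x = 0) ->
  forall i st, Inv i st -> exists t st',
    [/\ exec (While x (Seq (Defs.Sub x x 1) p)) st t st', t <= i * (T + 2) + 1 & Inv 0 st'].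
Proof.
move=> step stop; elim=> [|i IH] st Inv_st.
  by exists 1, st; split => //; apply: ExecWhileDone; exact: stop.
have [rx r1 [t [st1 [e1 le1 Inv1]]]] := step _ _ Inv_st.
have [t2 [st2 [e2 le2 Inv2]]] := IH _ Inv1.
exists ((1 + t) + t2).+1, st2; split => //; last by rewrite mulSn; lia.
apply: ExecWhileLoop e2; first by rewrite rx.
apply: ExecSeq e1; rewrite (_ : i = reg st x - reg st 1); first exact: ExecSub.
by rewrite rx r1 subn1.
Qed.

Lemma loop_cost n c k t d : t <= n * (c * n.+1 ^ k + 1 + 2) + 1 + d ->
  t <= (c + d + 4) * n.+1 ^ k.+1.
Proof.
move=> /leq_trans; apply; rewrite expnS.
have: 0 < n.+1 ^ k by rewrite expn_gt0.
by move: (n.+1 ^ k) => m; nia.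
Qed.

(* All loops are executed exactly n times, which makes every program polynomial. *)
Lemma computes_sum b (h : nat -> env -> nat) : 0 < b -> (forall i, reads_below b (h i)) ->
  (forall y, b <= y -> computes y.+1 (fun rho => h (rho y) rho)) ->
  computes b (fun rho => \sum_(i < rho 0) h i rho).
Proof.
move=> b0 lh eh; split=> [rho rho' ag|b' b'2 le_b].
  by rewrite (ag 0 b0); apply: eq_bigr => i _; exact: lh.
have [p [c [k pP]]] := (eh b' le_b).2 b'.+2 (ltnW (ltnW b'2)) (leqnSn _).
(* [b'] is the counter, [b'.+1] the accumulator, and [b'.+2] receives the summand. As the counter
   runs downwards, the accumulator holds the terms from the current index up to [n - 1]. *)
pose body := Seq p (Add b'.+1 b'.+1 b'.+2).
exists (Seq (Const b'.+1 0) (Seq (Add b' 0 2)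
  (Seq (While b' (Seq (Defs.Sub b' b' 1) body)) (Add b' b'.+1 2)))), (c + 3 + 4), k.+1 => st [r1 r2].
pose n := reg st 0.
pose Inv i st' := [/\ reg st' b' = i, i <= n, agree b' (reg st') (reg st), out st' = out st &
  reg st' b'.+1 = \sum_(i <= j < n) h j (reg st)].
have neq1 : b'.+1 <> b' by lia.
pose st1 := set_reg (set_reg st b'.+1 0) b' n.
have Inv1 : Inv n st1.
  split=> //=; rewrite ?updE //; last by rewrite upd_neq // updE big_geq.
  apply: agree_trans (agree_upd _ _ (leqnn _)) _; exact: agree_upd (leqnSn _).
have step i st' : Inv i.+1 st' -> [/\ reg st' b' = i.+1, reg st' 1 = 1 &
    exists t st'', [/\ exec body (set_reg st' b' i) t st'', t <= c * n.+1 ^ k + 1 & Inv i st'']].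
  case=> rb lt_i ag ot acc; split=> //; first by rewrite ag //; lia.
  have ag' : agree b' (reg (set_reg st' b' i)) (reg st).
    by apply: agree_trans ag; exact: agree_upd.
  have [st2 [[t et let_] v2 ag2 out2]] := pP _ (agree_ready b'2 ag' (conj r1 r2)).
  have r0 : reg (set_reg st' b' i) 0 = n by rewrite ag' //; lia.
  exists (t + 1), (set_reg st2 b'.+1 (reg st2 b'.+1 + reg st2 b'.+2)); split.
  + by apply: ExecSeq et _; exact: ExecAdd.
  + by rewrite leq_add2r -r0.
  + split=> //=.
    * by rewrite upd_neq; [rewrite ag2 ?updE //= updE|lia].
    * exact: ltnW.
    * apply: agree_trans (agree_upd _ _ (leqnSn _)) _; apply: agree_trans ag'.
      by apply: agreeW ag2; lia.
    * by rewrite out2.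
    * rewrite updE big_ltn // addnC v2 ag2 //= updE (upd_neq _ _ neq1) acc; congr (_ + _).
      exact: lh (agreeW le_b ag').
have stop st' : Inv 0 st' -> reg st' b' = 0 by case.
have [t [st2 [et let_ [rb _ ag ot acc]]]] := exec_countdown step stop Inv1.
exists (set_reg st2 b' (reg st2 b'.+1 + reg st2 2)); split => //=.
- exists (1 + (1 + (t + 1))); last by apply: loop_cost; rewrite -/n; lia.
  apply: ExecSeq (ExecConst _ _ _) _; apply: ExecSeq.
    by apply: ExecAdd.
  rewrite /= upd_neq; last by lia.
  rewrite upd_neq; last by lia.
  by rewrite r2 addn0; apply: ExecSeq et _; exact: ExecAdd.
- by rewrite updE acc ag // r2 addn0 big_mkord.
- by apply: agree_trans ag; exact: agree_upd.
Qed.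

Lemma outputs_out b f : computes b f -> outputs b (fun rho => [:: f rho]).
Proof.
move=> [lf ef]; split=> [rho rho' ag|b' b'2 le_b]; first by rewrite (lf _ rho').
have [p [c [k pP]]] := ef b' b'2 le_b.
exists (Seq p (Output b')), (c + 1), (k + 0) => st rst.
have [st1 [run1 v1 ag1 out1]] := pP st rst.
exists (emit st1 (reg st1 b')); split => //=; last by rewrite v1 out1 cats1.
by apply: run_seq run1 _; [rewrite ag1 //; lia|exact/run_const/ExecOutput].
Qed.

Lemma outputs_nil b : outputs b (fun=> [::]).
Proof.
split=> // b' b'2 le_b; exists (Const b' 0), 1, 0 => st rst.
exists (set_reg st b' 0); split; last by rewrite cats0.
  by apply: run_const; exact: ExecConst.
exact: agree_upd.
Qed.

Lemma outputs_cat b w1 w2 : outputs b w1 -> outputs b w2 -> outputs b (fun rho => w1 rho ++ w2 rho).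
Proof.
move=> [lf ef] [lg eg]; split=> [rho rho' ag|b' b'2 le_b].
  by rewrite (lf _ rho') // (lg _ rho').
have [p1 [c1 [k1 pP1]]] := ef b' b'2 le_b.
have [p2 [c2 [k2 pP2]]] := eg b' b'2 le_b.
exists (Seq p1 p2), (c1 + c2), (k1 + k2) => st rst.
have [st1 [run1 ag1 out1]] := pP1 st rst.
have [st2 [run2 ag2 out2]] := pP2 st1 (agree_ready b'2 ag1 rst).
exists st2; split.
- by apply: run_seq run1 run2; rewrite ag1 //; lia.
- exact: agree_trans ag1.
- by rewrite out2 out1 -catA (lg _ (reg st)) //; apply: agreeW ag1.
Qed.

Lemma outputs_flatten b (T : Type) (s : seq T) (w : T -> env -> seq nat) :
  (forall x, outputs b (w x)) -> outputs b (fun rho => flatten [seq w x rho | x <- s]).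
Proof.
by move=> gw; elim: s => [|x s IH] /=; [exact: outputs_nil|exact: outputs_cat].
Qed.

Lemma outputs_when b f w : computes b f -> outputs b w ->
  outputs b (fun rho => if f rho != 0 then w rho else [::]).
Proof.
move=> [lf ef] [lg eg]; split=> [rho rho' ag|b' b'2 le_b].
  by rewrite (lf _ rho') // (lg _ rho').
have [p1 [c1 [k1 pP1]]] := ef b' b'2 le_b.
have [p2 [c2 [k2 pP2]]] := eg b' b'2 le_b.
have [p3 [c3 [k3 pP3]]] := (outputs_nil b).2 b' b'2 le_b.
exists (Seq p1 (If b' p2 p3)), (c1 + (c2 + c3).+1), (k1 + (k2 + k3)) => st rst.
have [st1 [run1 v1 ag1 out1]] := pP1 st rst.
have rst1 := agree_ready b'2 ag1 rst.
have [st2 [run2 ag2 out2]] : exists st2, [/\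
    run_to (if reg st1 b' != 0 then p2 else p3) (if reg st1 b' != 0 then c2 else c3)
      (if reg st1 b' != 0 then k2 else k3) st1 st2,
    agree b' (reg st2) (reg st1) &
    out st2 = out st1 ++ (if f (reg st) != 0 then w (reg st) else [::])].
  rewrite v1; case: ifP => _; last exact: pP3.
  rewrite (lg _ (reg st1)); first exact: pP2.
  by apply: agree_sym; apply: agreeW ag1.
exists st2; split => //; last by rewrite out2 out1.
  by apply: run_seq run1 _; [rewrite ag1 //; lia|exact: run_if].
exact: agree_trans ag1.
Qed.

(** The list is reversed because the counter runs downwards. *)
Lemma outputs_for b (w : nat -> env -> seq nat) : 0 < b -> (forall i, reads_below b (w i)) ->
  (forall y, b <= y -> outputs y.+1 (fun rho => w (rho y) rho)) ->
  outputs b (fun rho => flatten [seq w i rho | i <- rev (iota 0 (rho 0))]).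
Proof.
move=> b0 lh eh; split=> [rho rho' ag|b' b'2 le_b].
  by rewrite (ag 0 b0); congr flatten; apply: eq_map => i; exact: lh.
have [p [c [k pP]]] := (eh b' le_b).2 b'.+1 (ltnW b'2) (leqnn _).
exists (Seq (Add b' 0 2) (While b' (Seq (Defs.Sub b' b' 1) p))), (c + 3 + 4), k.+1 => st [r1 r2].
pose n := reg st 0.
pose Inv i st' := [/\ reg st' b' = i, i <= n, agree b' (reg st') (reg st) &
  out st' = out st ++ flatten [seq w j (reg st) | j <- rev (iota i (n - i))]].
pose st1 := set_reg st b' n.
have Inv1 : Inv n st1.
  split=> //=; rewrite ?updE //; last by rewrite subnn cats0.
  exact: agree_upd.
have step i st' : Inv i.+1 st' -> [/\ reg st' b' = i.+1, reg st' 1 = 1 &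
    exists t st'', [/\ exec p (set_reg st' b' i) t st'', t <= c * n.+1 ^ k + 1 & Inv i st'']].
  case=> rb lt_i ag ot; split=> //; first by rewrite ag //; lia.
  have ag' : agree b' (reg (set_reg st' b' i)) (reg st).
    by apply: agree_trans ag; exact: agree_upd.
  have [st2 [[t et let_] ag2 out2]] := pP _ (agree_ready b'2 ag' (conj r1 r2)).
  have r0 : reg (set_reg st' b' i) 0 = n by rewrite ag' //; lia.
  exists t, st2; split => //; first by rewrite r0 in let_; apply: leq_trans let_ (leq_addr _ _).
  split.
  + by rewrite ag2 //= updE.
  + exact: ltnW.
  + by apply: agree_trans ag'; exact: agreeW (leqnSn _) ag2.
  + rewrite out2 /= ot -catA; congr (_ ++ _).
    rewrite -(subnSK lt_i) /= rev_cons map_rcons.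
    rewrite -cats1 flatten_cat /= cats0 updE; congr (_ ++ _).
    exact: lh (agreeW le_b ag').
have stop st' : Inv 0 st' -> reg st' b' = 0 by case.
have [t [st2 [et let_ [rb _ ag ot]]]] := exec_countdown step stop Inv1.
exists st2; split => //=; last by rewrite ot subn0.
exists (1 + t); last by apply: loop_cost; rewrite -/n; lia.
apply: ExecSeq (_ : exec _ _ _ st1) et.
have -> : st1 = set_reg st b' (reg st 0 + reg st 2) by rewrite r2 addn0.
exact: ExecAdd.
Qed.

End Programs.

(* Arithmetic by loops of length n is exact only as long as the number of
   iterations needed does not exceed n. *)
Definition mulc n a b := a * minn b n.
Definition divc n a b := \sum_(i < n) (mulc n b i.+1 <= a).
Definition modc n a b := a - mulc n b (divc n a b).
Definition powc n a k := iter k (fun x => mulc n x a) 1.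

Lemma sum_ltn n m : \sum_(i < n) (i < m) = minn m n.
Proof.
elim: n => [|n IH]; first by rewrite big_ord0 minn0.
by rewrite big_ord_recr /= IH; case: ltnP => ?; lia.
Qed.

Lemma mulcE n a b : b <= n -> mulc n a b = a * b.
Proof. by rewrite /mulc => /minn_idPl ->. Qed.

Lemma divcE n a b : 0 < b -> a %/ b <= n -> divc n a b = a %/ b.
Proof.
move=> b0 le_n; rewrite /divc -[RHS](minn_idPl le_n) -sum_ltn.
by apply: eq_bigr => i _; rewrite mulcE // mulnC -leq_divRL.
Qed.

Lemma modcE n a b : 0 < b -> a %/ b <= n -> modc n a b = a %% b.
Proof.
move=> b0 le_n; rewrite /modc divcE // mulcE //.
by rewrite {1}(divn_eq a b) mulnC addKn.
Qed.

Lemma powcE n a k : a <= n -> powc n a k = a ^ k.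
Proof. by move=> le_n; elim: k => //= k IH; rewrite IH mulcE // expnSr. Qed.

Section Expressions.
Notation env := (nat -> nat).

Lemma computes_add b f g : computes b f -> computes b g -> computes b (fun rho => f rho + g rho).
Proof. by apply: (@computes_bin addn Add) => *; exact: ExecAdd. Qed.

Lemma computes_sub b f g : computes b f -> computes b g -> computes b (fun rho => f rho - g rho).
Proof. by apply: (@computes_bin subn Defs.Sub) => *; exact: ExecSub. Qed.

Lemma computes_leq b f g : computes b f -> computes b g -> computes b (fun rho => f rho <= g rho).
Proof.
move=> ef eg; apply: (@eq_computes _ (fun rho => if (g rho).+1 - f rho != 0 then 1 else 0)).
  by move=> rho; rewrite subn_eq0 -ltnNge ltnS; case: (_ <= _).
apply: computes_if (computes_const _ _) (computes_const _ _); apply: computes_sub ef.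
apply: (@eq_computes _ (fun rho => g rho + 1)); first by move=> rho; rewrite addn1.
exact: computes_add eg (computes_const _ _).
Qed.

Lemma computes_and b (f g : env -> bool) :
  computes b f -> computes b g -> computes b (fun rho => f rho && g rho).
Proof.
move=> ef eg; apply: (@eq_computes _ (fun rho => if (f rho : nat) != 0 then g rho : nat else 0)).
  by move=> rho; case: (f rho).
exact: computes_if (computes_const _ _).
Qed.

Lemma computes_not b (f : env -> bool) : computes b f -> computes b (fun rho => ~~ f rho).
Proof.
move=> ef; apply: (@eq_computes _ (fun rho => 1 - f rho)).
  by move=> rho; case: (f rho).
exact: computes_sub (computes_const _ _) ef.
Qed.

Lemma computes_eq b f g : computes b f -> computes b g -> computes b (fun rho => f rho == g rho).
Proof.
move=> ef eg; apply: (@eq_computes _ (fun rho => (f rho <= g rho) && (g rho <= f rho))).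
  by move=> rho; rewrite eqn_leq.
by apply: computes_and; apply: computes_leq.
Qed.

(** The hypothesis asks for [h] at every computable index: constant indices show which registers [h]
    reads, and the loop register as index yields the loop body. *)
Lemma computes_sum_lt b (h : nat -> env -> nat) : 0 < b ->
    (forall b' f, b <= b' -> computes b' f -> computes b' (fun rho => h (f rho) rho)) ->
  computes b (fun rho => \sum_(i < rho 0) h i rho).
Proof.
move=> b0 eh; apply: computes_sum => // [i|y le_b].
  exact: (eh b _ (leqnn _) (computes_const b i)).1.
by apply: eh; [exact: leqW|exact: computes_reg].
Qed.

Lemma outputs_for_lt b (w : nat -> env -> seq nat) : 0 < b ->
    (forall b' f, b <= b' -> computes b' f -> outputs b' (fun rho => w (f rho) rho)) ->
  outputs b (fun rho => flatten [seq w i rho | i <- rev (iota 0 (rho 0))]).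
Proof.
move=> b0 eh; apply: outputs_for => // [i|y le_b].
  exact: (eh b _ (leqnn _) (computes_const b i)).1.
by apply: eh; [exact: leqW|exact: computes_reg].
Qed.

Lemma computes_exists b (P : nat -> env -> bool) : 0 < b ->
    (forall b' f, b <= b' -> computes b' f -> computes b' (fun rho => P (f rho) rho)) ->
  computes b (fun rho => [exists i : 'I_(rho 0), P i rho]).
Proof.
move=> b0 eP.
apply: (@eq_computes _ (fun rho => if \sum_(i < rho 0) P i rho != 0 then 1 else 0)).
  move=> rho; have -> : (\sum_(i < rho 0) P i rho != 0) = [exists i : 'I_(rho 0), P i rho].
    by rewrite sum_nat_eq0 negb_forall; apply: eq_existsb => i /=; case: (P i rho).
  by case: ([exists _, _]).
apply: computes_if (computes_const _ _) (computes_const _ _).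
exact: (@computes_sum_lt b (fun i rho => P i rho)).
Qed.

(** The list is fixed in advance, so the fold is unrolled in the program text instead of being run
    as a loop. *)
Lemma computes_big b (T : Type) (s : seq T) (op : env -> nat -> nat -> nat) x (F : T -> env -> nat) :
    (forall f g, computes b f -> computes b g -> computes b (fun rho => op rho (f rho) (g rho))) ->
    (forall i, computes b (F i)) ->
  computes b (fun rho => \big[op rho/x]_(i <- s) F i rho).
Proof.
move=> eop eF; elim: s => [|i s IH].
  by apply: eq_computes (computes_const b x) => rho; rewrite big_nil.
by apply: eq_computes (eop _ _ (eF i) IH) => rho; rewrite big_cons.
Qed.

Lemma computes_mulc b f g : 0 < b -> computes b f -> computes b g ->
  computes b (fun rho => mulc (rho 0) (f rho) (g rho)).
Proof.
move=> b0 ef eg.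
apply: (@eq_computes _ (fun rho => \sum_(i < rho 0) if (i < g rho : nat) != 0 then f rho else 0)).
  move=> rho; rewrite /mulc -sum_ltn big_distrr; apply: eq_bigr => i _ /=.
  by case: (i < g rho); rewrite ?muln1 ?muln0.
apply: (@computes_sum_lt _ (fun i rho => if (i < g rho : nat) != 0 then f rho else 0)) => // b' h le_b eh.
apply: computes_if (computesW le_b ef) (computes_const _ _).
apply: (@eq_computes _ (fun rho => h rho + 1 <= g rho)); first by move=> rho; rewrite addn1.
by apply: computes_leq; [exact: computes_add (computes_const _ _)|exact: computesW eg].
Qed.

Lemma computes_divc b f g : 0 < b -> computes b f -> computes b g ->
  computes b (fun rho => divc (rho 0) (f rho) (g rho)).
Proof.
move=> b0 ef eg.
apply: (@computes_sum_lt _ (fun i rho => mulc (rho 0) (g rho) i.+1 <= f rho)) => // b' h le_b eh.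
have b'0 := leq_trans b0 le_b.
apply: computes_leq (computesW le_b ef); apply: computes_mulc (computesW le_b eg) _ => //.
by apply: eq_computes (computes_add eh (computes_const _ 1)) => rho; rewrite addn1.
Qed.

Lemma computes_modc b f g : 0 < b -> computes b f -> computes b g ->
  computes b (fun rho => modc (rho 0) (f rho) (g rho)).
Proof. by move=> b0 ef eg; apply/computes_sub/computes_mulc/computes_divc. Qed.

Lemma computes_iter b k (op : env -> nat -> nat) f :
    (forall f, computes b f -> computes b (fun rho => op rho (f rho))) ->
  computes b f -> computes b (fun rho => iter k (op rho) (f rho)).
Proof. by move=> eop ef; elim: k => //= k; exact: eop. Qed.

Lemma computes_powc b k f : 0 < b -> computes b f -> computes b (fun rho => powc (rho 0) (f rho) k).
Proof.
move=> b0 ef; apply: computes_iter (computes_const b 1) => g eg; exact: computes_mulc.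
Qed.

End Expressions.

(** * Search for the prime *)

Definition primec n i := (1 < i) &&
  ~~ [exists a : 'I_n, [&& 1 < a, a < i & modc n i a == 0]].

Definition fits n e i := primec n i && (powc n i e <= n).

(** The largest fitting prime is unique, so a loop over all candidates passes this guard at most
    once. *)
Definition chosen n e i := fits n e i && ~~ [exists j : 'I_n, (i < j) && fits n e j].

Lemma computes_ltn b f g : computes b f -> computes b g -> computes b (fun rho => f rho < g rho).
Proof.
move=> ef eg; apply: (@eq_computes _ (fun rho => f rho + 1 <= g rho)).
  by move=> rho; rewrite addn1.
exact: computes_leq (computes_add ef (computes_const _ _)) eg.
Qed.

Lemma computes_fits b e f : 0 < b -> computes b f -> computes b (fun rho => fits (rho 0) e (f rho)).
Proof.
move=> b0 ef; apply: computes_and; last first.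
  by apply: computes_leq (computes_reg b0); exact: computes_powc.
apply: computes_and (computes_ltn (computes_const _ _) ef) _; apply: computes_not.
apply: (@computes_exists _ (fun a rho => [&& 1 < a, a < f rho & modc (rho 0) (f rho) a == 0])) => //.
move=> b' g le_b eg; have b'0 := leq_trans b0 le_b; have ef' := computesW le_b ef.
apply: computes_and (computes_ltn (computes_const _ _) eg) _; apply: computes_and (computes_ltn eg ef') _.
by apply: computes_eq (computes_const _ _); exact: computes_modc.
Qed.

Lemma computes_chosen b e f : 0 < b -> computes b f -> computes b (fun rho => chosen (rho 0) e (f rho)).
Proof.
move=> b0 ef; apply: computes_and (computes_fits e b0 ef) _; apply: computes_not.
apply: (@computes_exists _ (fun a rho => (f rho < a) && fits (rho 0) e a)) => // b' g le_b eg.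
have b'0 := leq_trans b0 le_b; have ef' := computesW le_b ef.
exact: computes_and (computes_ltn ef' eg) (computes_fits e b'0 eg).
Qed.

Lemma primecE n i : i <= n -> primec n i = prime i.
Proof.
move=> le_in; apply/andP/primeP => [[i1 no_div]|[i1 i_div]]; split=> //.
  move=> a a_div; apply/norP => -[a1 ai]; case/negP: no_div; apply/existsP.
  have a_le : a <= i by apply: dvdn_leq => //; exact: ltnW.
  have lt_ai : a < i by rewrite ltn_neqAle ai.
  have a0 : 0 < a by apply: dvdn_gt0 a_div; exact: ltnW.
  exists (Ordinal (leq_trans lt_ai le_in)) => /=.
  rewrite lt_ai modcE //; last by apply: leq_trans (leq_div _ _) le_in.
  by rewrite (eqP a_div) ltn_neqAle eq_sym a1 a0.
apply/existsP => -[a /and3P[a1 lt_ai]].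
rewrite modcE; [|exact: ltnW|exact: leq_trans (leq_div _ _) le_in].
by case/i_div/orP => /eqP ai; rewrite ai ?ltnn in a1 lt_ai.
Qed.

Lemma chosenP n e i : i < n -> chosen n e i -> [/\ prime i, i ^ e <= n &
  forall p, prime p -> p < n -> p ^ e <= n -> p <= i].
Proof.
move=> lt_in /andP[/andP[]]; rewrite primecE ?powcE ?(ltnW lt_in) // => i_pr le_n.
move=> /existsPn max_i; split=> // p p_pr lt_pn p_le; rewrite leqNgt.
have := max_i (Ordinal lt_pn); rewrite /fits /= primecE ?powcE ?(ltnW lt_pn) //.
by rewrite p_pr p_le !andbT.
Qed.

Lemma chosen_ex n e p : prime p -> p < n -> p ^ e <= n -> exists2 i, i < n & chosen n e i.
Proof.
move=> p_pr lt_pn p_le; pose P i := (i < n) && fits n e i.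
have exP : exists i, P i by exists p; rewrite /P /fits lt_pn primecE ?powcE ?p_pr ?p_le // ltnW.
have ubP i : P i -> i <= n by case/andP => /ltnW.
case: (ex_maxnP exP ubP) => i /andP[lt_in fit_i] max_i; exists i => //.
rewrite /chosen fit_i; apply/existsPn => j; apply/negP => /andP[lt_ij fit_j].
by have := max_i j; rewrite /P ltn_ord fit_j => /(_ isT); rewrite leqNgt lt_ij.
Qed.

(** * The line system as a program *)

Lemma digits_lt q d (u : nat -> nat) : (forall i, i < d -> u i < q) ->
  \sum_(i < d) u i * q ^ i < q ^ d.
Proof.
elim: d => [|d IH] lt_u; first by rewrite big_ord0.
rewrite big_ord_recr /= expnS; have := IH (fun i lt_i => lt_u i (leqW lt_i)).
have := lt_u d (ltnSn d); move: (\sum_(i < d) _) (q ^ d) (u d) => s m a; nia.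
Qed.

Lemma digits_div q d c (u : nat -> nat) : (forall i, i < d -> u i < q) ->
  (c * q ^ d + \sum_(i < d) u i * q ^ i) %/ q ^ d = c.
Proof.
move=> lt_u; have lt_s := digits_lt lt_u.
by rewrite divnMDl ?divn_small ?addn0 //; apply: leq_ltn_trans lt_s.
Qed.

Lemma digits_mod q d c (u : nat -> nat) m : (forall i, i < d -> u i < q) -> m < d ->
  (c * q ^ d + \sum_(i < d) u i * q ^ i) %/ q ^ m %% q = u m.
Proof.
elim: d c => // d IH c lt_u; rewrite ltnS big_ord_recr /= => le_md.
have lt_u' i : i < d -> u i < q by move=> lt_i; apply: lt_u; exact: leqW.
have -> : c * q ^ d.+1 + (\sum_(i < d) u i * q ^ i + u d * q ^ d) =
    (c * q + u d) * q ^ d + \sum_(i < d) u i * q ^ i by rewrite expnS; ring.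
case: ltngtP le_md => // [lt_md _|-> _]; first exact: IH.
by rewrite digits_div // modnMDl modn_small // lt_u.
Qed.

Lemma digits_expand q d v : 0 < q ->
  \sum_(i < d) (v %/ q ^ i %% q) * q ^ i = v %% q ^ d.
Proof.
move=> q0; elim: d => [|d IH]; first by rewrite big_ord0 modn1.
rewrite big_ord_recr /= IH.
have qd0 : 0 < q ^ d by rewrite expn_gt0 q0.
rewrite [in RHS](divn_eq v (q ^ d)) [in RHS](divn_eq (v %/ q ^ d) q).
rewrite mulnDl -mulnA -expnS -addnA modnMDl.
rewrite [RHS]modn_small addnC // expnS.
have := ltn_pmod v qd0; have := ltn_pmod (v %/ q ^ d) q0.
move: (v %% q ^ d) (q ^ d) (v %/ q ^ d %% q) => a b e; nia.
Qed.

Section Spec.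
Variable r : nat.
Notation M := (r.+1 * 2 ^ r).
Notation I := ('I_M + 'I_r * 'I_M * 'I_(2 ^ r))%type.
Notation d := #|{: I}|.
Notation k := d.+1.
(** The factor 2 makes a block of [q ^ k] vertices no larger than the square root of [n], so that an
    incomplete last block is negligible. *)
Notation e := (2 * k).

Definition addm n q a b := modc n (a + b) q.
Definition mulm n q a b := modc n (mulc n a b) q.
Definition digit n q x i := modc n (divc n x (powc n q i)) q.

(* The coordinates of x and z are their digits in base q. *)
Definition slope n q (z : nat) (i : I) := digit n q z (enum_rank i).

Definition abscissa n q z (l : 'I_r) :=
  \big[addm n q/0]_(m < M) \big[addm n q/0]_(i < 2 ^ r)
    mulm n q (slope n q z (inr (l, m, i)))
      (iter i (fun x => mulm n q x (slope n q z (inl m))) 1).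

Definition distinct n q z :=
  \sum_(l1 < r) \sum_(l2 < r) ((l1 < l2) && (abscissa n q z l1 == abscissa n q z l2)) == 0.

(** The pair of abscissa [tau] and vector with digits [u] has the number [(j * q + tau) * q ^ d + u]
    in block [j]. Blocks of [q ^ k] consecutive vertices carry disjoint copies of the line
    system. *)
Definition point n q j x z (l : 'I_r) :=
  mulc n (mulc n j q + abscissa n q z l) (powc n q d) +
  \sum_(i < d) mulc n (addm n q (digit n q x i) (mulm n q (abscissa n q z l) (digit n q z i)))
                 (powc n q i).

Definition edge_list n q j x z := [seq point n q j x z l | l <- enum 'I_r].

(** The guards restrict loops of length [n] to the chosen prime, to blocks that fit completely below
    [n], and to numbers [x], [z] of vectors with [d] digits. *)
Definition all_edges n :=
  flatten [seq if chosen n e q then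
    flatten [seq if mulc n (powc n q k) j.+1 <= n then
      flatten [seq if x < powc n q d then
        flatten [seq if (z < powc n q d) && distinct n q z then edge_list n q j x z else [::]
          | z <- rev (iota 0 n)] else [::]
        | x <- rev (iota 0 n)] else [::]
      | j <- rev (iota 0 n)] else [::]
    | q <- rev (iota 0 n)].

Lemma outputs_guard b (P : (nat -> nat) -> bool) w : computes b P -> outputs b w ->
  outputs b (fun rho => if P rho then w rho else [::]).
Proof.
move=> eP gw; apply: eq_outputs (outputs_when eP gw) => rho.
by case: (P rho).
Qed.

Section Gen.
Variables (b : nat) (q j x z : (nat -> nat) -> nat).
Hypotheses (b0 : 0 < b) (eq : computes b q) (ej : computes b j) (ex : computes b x) (ez : computes b z).

Lemma computes_mulm f g : computes b f -> computes b g ->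
  computes b (fun rho => mulm (rho 0) (q rho) (f rho) (g rho)).
Proof. by move=> ef eg; apply: computes_modc (computes_mulc _ _ _) _. Qed.

Lemma computes_addm f g : computes b f -> computes b g ->
  computes b (fun rho => addm (rho 0) (q rho) (f rho) (g rho)).
Proof. by move=> ef eg; apply: computes_modc (computes_add _ _) _. Qed.

Lemma computes_digit f i : computes b f -> computes b (fun rho => digit (rho 0) (q rho) (f rho) i).
Proof. by move=> ef; apply: computes_modc (computes_divc _ _ (computes_powc _ _ _)) _. Qed.

Lemma computes_abscissa l : computes b (fun rho => abscissa (rho 0) (q rho) (z rho) l).
Proof.
apply: (@computes_big b 'I_M _ (fun rho => addm (rho 0) (q rho))) => [f g|m].
  exact: computes_addm.
apply: (@computes_big b _ _ (fun rho => addm (rho 0) (q rho))) => [f g|i].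
  exact: computes_addm.
apply: computes_mulm; first exact: computes_digit.
apply: (@computes_iter b i (fun rho x => mulm (rho 0) (q rho) x (slope (rho 0) (q rho) (z rho) (inl m)))
  (fun=> 1)); last exact: computes_const.
by move=> f ef; apply: computes_mulm => //; exact: computes_digit.
Qed.

Lemma computes_distinct : computes b (fun rho => distinct (rho 0) (q rho) (z rho)).
Proof.
apply: computes_eq (computes_const _ _).
apply: (@computes_big b _ _ (fun=> addn)) => [f g|l1]; first exact: computes_add.
apply: (@computes_big b _ _ (fun=> addn)) => [f g|l2]; first exact: computes_add.
apply: (@computes_and b (fun=> l1 < l2)); first exact: computes_const.
by apply: computes_eq; exact: computes_abscissa.
Qed.

Lemma outputs_edge : outputs b (fun rho => edge_list (rho 0) (q rho) (j rho) (x rho) (z rho)).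
Proof.
apply: (@eq_outputs _ (fun rho => flatten [seq [:: point (rho 0) (q rho) (j rho) (x rho) (z rho) l]
  | l <- enum 'I_r])).
  by move=> rho; rewrite /edge_list; elim: (enum _) => //= l s ->.
apply: (@outputs_flatten b _ _ (fun l rho => [:: point (rho 0) (q rho) (j rho) (x rho) (z rho) l])) => l.
apply: outputs_out; apply: computes_add.
  by apply: computes_mulc (computes_add (computes_mulc _ _ _) (computes_abscissa _)) (computes_powc _ _ _).
apply: (@computes_big b _ _ (fun=> addn)) => [f g|i]; first exact: computes_add.
apply: computes_mulc (computes_powc _ _ _) => //; apply: computes_addm; first exact: computes_digit.
by apply: computes_mulm; [exact: computes_abscissa|exact: computes_digit].
Qed.

End Gen.

Lemma outputs_all_edges b : 0 < b -> outputs b (fun rho => all_edges (rho 0)).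
Proof.
move=> b0.
apply: (@outputs_for_lt b (fun q rho => if chosen (rho 0) e q then _ else [::])) => // b1 q le1 eq.
have b10 := leq_trans b0 le1; apply: outputs_guard; first exact: computes_chosen.
apply: (@outputs_for_lt b1 (fun j rho => if mulc (rho 0) (powc (rho 0) (q rho) k) j.+1 <= rho 0
  then _ else [::])) => // b2 j le2 ej.
have b20 := leq_trans b10 le2; have {}eq := computesW le2 eq; apply: outputs_guard.
  apply: computes_leq (computes_reg b20); apply: computes_mulc (computes_powc _ _ _) _ => //.
  by apply: eq_computes (computes_add ej (computes_const _ 1)) => rho; rewrite addn1.
apply: (@outputs_for_lt b2 (fun x rho => if x < powc (rho 0) (q rho) d then _ else [::])) => // b3 x le3 ex.
have b30 := leq_trans b20 le3; have {}eq := computesW le3 eq; have {}ej := computesW le3 ej.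
apply: outputs_guard; first exact: computes_ltn (computes_powc _ _ _).
apply: (@outputs_for_lt b3 (fun z rho => if (z < powc (rho 0) (q rho) d) && distinct (rho 0) (q rho) z
  then edge_list (rho 0) (q rho) (j rho) (x rho) z else [::])) => // b4 z le4 ez.
have b40 := leq_trans b30 le4; have {}eq := computesW le4 eq.
have {}ej := computesW le4 ej; have {}ex := computesW le4 ex; apply: outputs_guard; last exact: outputs_edge.
by apply: computes_and (computes_ltn ez (computes_powc _ _ _)) _ => //; exact: computes_distinct.
Qed.

Lemma exec_all_edges : exists p c kk, forall n, exists t st,
  [/\ exec p (init n) t st, t <= c * n.+1 ^ kk & out st = all_edges n].
Proof.
have [_ /(_ 3 isT isT) [p [c [kk pP]]]] := outputs_all_edges (isT : 0 < 3).
(* The first instruction establishes [ready]: register 2 is 0 from the start. *)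
exists (Seq (Const 1 1) p), (1 + c), (0 + kk) => n.
have [|st [run _ out_st]] := pP (set_reg (init n) 1 1); first by split.
have eq0 : reg (set_reg (init n) 1 1) 0 = reg (init n) 0 by [].
have [t et let_] := run_seq eq0 (run_const (ExecConst (init n) 1 1)) run.
by exists t, st; rewrite out_st.
Qed.

End Spec.

(** * Reading the edges off the output *)

(** Order and repetitions of the listed edges are forgotten, since the hypergraph is the set of
    their values. *)
Definition enumerates (w : seq nat) (P : seq nat -> Prop) :=
  exists2 ls, w = flatten ls & forall l, l \in ls <-> P l.

Lemma enumerates_iff w P Q : (forall l, P l <-> Q l) -> enumerates w P -> enumerates w Q.
Proof. by move=> PQ [ls -> lsP]; exists ls => // l; rewrite lsP. Qed.

Lemma enumerates_single w : enumerates w (fun l => l = w).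
Proof.
by exists [:: w]; rewrite /= ?cats0 // => l; rewrite inE; split=> [/eqP|->].
Qed.

Lemma enumerates_guard (b : bool) w P : enumerates w P ->
  enumerates (if b then w else [::]) (fun l => b /\ P l).
Proof.
case: b => [|_]; first by apply: enumerates_iff => l; split=> [|[]].
by exists [::] => // l; split=> [|[]].
Qed.

Lemma enumerates_flatten (s : seq nat) f P : (forall i, enumerates (f i) (P i)) ->
  enumerates (flatten [seq f i | i <- s]) (fun l => exists2 i, i \in s & P i l).
Proof.
move=> fP; elim: s => [|i s [ls1 eq1 ls1P]] /=.
  by exists [::] => // l; split=> // -[].
have [ls2 eq2 ls2P] := fP i; exists (ls2 ++ ls1); first by rewrite flatten_cat -eq1 -eq2.
move=> l; rewrite mem_cat; split.
  case/orP=> [/ls2P Pl|/ls1P[i' i's Pl]]; first by exists i; rewrite ?mem_head.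
  by exists i'; rewrite // inE i's orbT.
case=> i'; rewrite inE => /orP[/eqP-> /ls2P ->//|i's Pl].
by apply/orP; right; apply/ls1P; exists i'.
Qed.

Lemma ordinal_tuples n r (ls : seq (seq nat)) :
    (forall l, l \in ls -> size l = r /\ forall v, v \in l -> v < n) ->
  exists es : seq (r.-tuple 'I_n), [seq [seq val v | v <- tval e] | e <- es] = ls.
Proof.
elim: ls => [|l ls IH] lsP; first by exists [::].
have [es <-] := IH (fun l' l'in => lsP l' (mem_behead (l'in : l' \in behead (l :: ls)))).
have [sz_l lt_l] := lsP l (mem_head _ _).
have [s sE] : exists s : seq 'I_n, [seq val v | v <- s] = l.
  elim: (l) lt_l => [|v l' IHl] lt_l; first by exists [::].
  have [s <-] := IHl (fun v' v'in => lt_l v' (mem_behead (v'in : v' \in behead (v :: l')))).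
  by exists (Ordinal (lt_l v (mem_head _ _)) :: s).
have sz_s : size s == r by rewrite -sz_l -sE size_map.
by exists (Tuple sz_s :: es); rewrite /= sE.
Qed.

(** * The program computes in the prime field *)

Section Correctness.
Variable r : nat.
Notation M := (r.+1 * 2 ^ r).
Notation I := ('I_M + 'I_r * 'I_M * 'I_(2 ^ r))%type.
Notation d := #|{: I}|.
Notation k := d.+1.
Notation e := (2 * k).

Lemma all_edgesP n : enumerates (all_edges r n) (fun l => exists q j x z,
  [/\ [&& q < n, j < n, x < n & z < n],
      [&& chosen n e q, mulc n (powc n q k) j.+1 <= n, x < powc n q d, z < powc n q d
        & distinct r n q z] & l = edge_list r n q j x z]).
Proof.
apply: enumerates_iff; last first.
  apply: enumerates_flatten => q; apply: enumerates_guard.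
  apply: enumerates_flatten => j; apply: enumerates_guard.
  apply: enumerates_flatten => x; apply: enumerates_guard.
  apply: enumerates_flatten => z; apply: enumerates_guard.
  exact: enumerates_single.
have mem_n i : (i \in rev (iota 0 n)) = (i < n) by rewrite mem_rev mem_iota.
move=> l; split.
  case=> q; rewrite mem_n => qn [cq [j]]; rewrite mem_n => jn [cj [x]].
  rewrite mem_n => xn [cx [z]]; rewrite mem_n => zn [/andP[cz dz] ->].
  by exists q, j, x, z; rewrite qn jn xn zn cq cj cx cz dz.
case=> q [j [x [z [/and4P[qn jn xn zn] /and5P[cq cj cx cz dz] ->]]]].
exists q; rewrite ?mem_n //; split=> //; exists j; rewrite ?mem_n //; split=> //.
exists x; rewrite ?mem_n //; split=> //; exists z; rewrite ?mem_n //.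
by rewrite cz dz.
Qed.

Section Fixed.
Variables (n q : nat).
Hypotheses (q_pr : prime q) (lt_qn : q < n) (q_le : q ^ e <= n).
Notation F := 'F_q.
Notation Z := {ffun I -> F^o}.

Let q0 : 0 < q := prime_gt0 q_pr.
Let le_qn : q <= n := ltnW lt_qn.

Lemma pow_le_n i : i <= e -> q ^ i <= n.
Proof. by move=> le_i; apply: leq_trans q_le; rewrite leq_pexp2l. Qed.

(** [base v] and [vec v] are the components [tau] and [u] of the vertex number [v]; its block is
    [v %/ q ^ k]. *)
Definition vec (v : nat) : Z := [ffun i : I => (v %/ q ^ enum_rank i %% q)%:R%R].

Definition base (v : nat) : F := (v %/ q ^ d %% q)%:R%R.

(** Simulation relation between numbers in registers and field elements. The reduced representative
    is unique, so comparing numbers decides equality in the field. *)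
Definition represents (a : nat) (f : F) := a < q /\ a%:R%R = f.

Lemma represents_mod a : represents (a %% q) a%:R%R.
Proof. by split; [rewrite ltn_mod|rewrite Fp_nat_mod]. Qed.

Lemma digitE x i : x <= n -> digit n q x i = x %/ q ^ i %% q.
Proof.
move=> le_xn; rewrite /digit powcE // divcE ?expn_gt0 ?q0 //.
  by rewrite modcE //; apply: leq_trans (leq_div _ _) (leq_trans (leq_div _ _) le_xn).
exact: leq_trans (leq_div _ _) le_xn.
Qed.

Lemma div_le_n v : v <= n * q -> v %/ q <= n.
Proof. by move=> le_v; rewrite -(mulnK n q0) leq_div2r. Qed.

Lemma represents_mulm a b f g : represents a f -> represents b g ->
  represents (mulm n q a b) (f * g)%R.
Proof.
move=> [lt_a <-] [lt_b <-]; rewrite /mulm mulcE; last exact: leq_trans (ltnW lt_b) le_qn.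
rewrite modcE // -?natrM; first exact: represents_mod.
by apply: div_le_n; rewrite leq_mul ?(ltnW lt_b) // (leq_trans (ltnW lt_a)).
Qed.

Lemma represents_addm a b f g : represents a f -> represents b g ->
  represents (addm n q a b) (f + g)%R.
Proof.
move=> [lt_a <-] [lt_b <-]; rewrite /addm modcE // -?natrD; first exact: represents_mod.
apply: div_le_n; have := prime_gt1 q_pr; move: lt_a lt_b le_qn; nia.
Qed.

Lemma represents_digit x (i : I) : x <= n -> represents (digit n q x (enum_rank i)) (vec x i).
Proof.
move=> le_xn; rewrite digitE // ffunE; split; first by rewrite ltn_mod.
by [].
Qed.

Lemma represents_abscissa z l : z <= n -> represents (abscissa n q z l) (hash (vec z) l).
Proof.
move=> le_zn; rewrite ffunE.
have rep0 : represents 0 0%R by [].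
apply: (big_ind2 represents) => // [*|m _]; first exact: represents_addm.
apply: (big_ind2 represents) => // [*|i _]; first exact: represents_addm.
apply: represents_mulm; first exact: represents_digit.
elim: (i : nat) => [|j IH] /=; first by split; rewrite ?prime_gt1.
by rewrite exprSr; apply: represents_mulm => //; exact: represents_digit.
Qed.

Lemma represents_inj a b f : represents a f -> represents b f -> a = b.
Proof.
move=> [lt_a <-] [lt_b /(congr1 (fun h : F => h : nat))]; rewrite !val_Fp_nat //.
by rewrite !modn_small.
Qed.

Lemma distinctP z : z <= n -> reflect (injective (hash (vec z))) (distinct r n q z).
Proof.
move=> le_zn; have rep l := represents_abscissa l le_zn.
have eq_abs l1 l2 : (abscissa n q z l1 == abscissa n q z l2) = (hash (vec z) l1 == hash (vec z) l2).
  apply/eqP/eqP => [eq_a|eq_h]; first by rewrite -(rep l1).2 eq_a (rep l2).2.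
  by apply: represents_inj (rep l1) _; rewrite eq_h.
rewrite /distinct sum_nat_eq0; apply: (iffP forallP) => [all0 l1 l2 eq_h|inj l1 /=].
  have lt_neq l l' : hash (vec z) l = hash (vec z) l' -> (l < l') = false.
    move=> eq_ll; have := all0 l; rewrite /= sum_nat_eq0 => /forallP/(_ l').
    by rewrite /= eq_abs eq_ll eqxx andbT eqb0 => /negbTE.
  apply: ord_inj; apply/eqP; rewrite eqn_leq leqNgt (lt_neq _ _ (esym eq_h)) leqNgt.
  by rewrite (lt_neq _ _ eq_h).
rewrite sum_nat_eq0; apply/forallP => l2 /=; rewrite eq_abs eqb0.
by apply/negP => /andP[lt_l /eqP/inj eq_l]; rewrite eq_l ltnn in lt_l.
Qed.

Section Point.
Variables (j x z : nat) (l : 'I_r).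
Hypotheses (le_xn : x <= n) (le_zn : z <= n).

Let u i := addm n q (digit n q x i) (mulm n q (abscissa n q z l) (digit n q z i)).

Let lt_u i : u i < q.
Proof.
have rep y : y <= n -> represents (digit n q y i) (digit n q y i)%:R%R.
  by move=> le_yn; split=> //; rewrite digitE // ltn_mod.
have [] // := represents_addm (rep x le_xn) (represents_mulm (represents_abscissa l le_zn) (rep z le_zn)).
Qed.

Lemma pointE : point n q j x z l =
  (j * q + abscissa n q z l) * q ^ d + \sum_(i < d) u i * q ^ i.
Proof.
rewrite /point !powcE // mulcE; last by rewrite pow_le_n //; lia.
rewrite mulcE //; congr (_ + _); apply: eq_bigr => i _.
by rewrite powcE // mulcE // pow_le_n //; have := ltn_ord i; lia.
Qed.

Lemma point_div : point n q j x z l %/ q ^ d = j * q + abscissa n q z l.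
Proof. by rewrite pointE digits_div. Qed.

Lemma point_block : point n q j x z l %/ q ^ k = j.
Proof.
rewrite expnSr divnMA point_div divnMDl // divn_small ?addn0 //.
by case: (represents_abscissa l le_zn).
Qed.

Lemma point_base : base (point n q j x z l) = hash (vec z) l.
Proof.
have [lt_a <-] := represents_abscissa l le_zn.
by rewrite /base point_div modnMDl modn_small.
Qed.

Lemma point_vec : vec (point n q j x z l) = (vec x + hash (vec z) l *: vec z)%R.
Proof.
apply/ffunP => i; rewrite ffunE pointE digits_mod //.
have [_ ->] : represents (u (enum_rank i)) (vec x i + hash (vec z) l * vec z i)%R.
  apply: represents_addm; first exact: represents_digit.
  by apply: represents_mulm (represents_abscissa l le_zn) _; exact: represents_digit.
by rewrite !ffunE.
Qed.

Lemma point_lt : q ^ k * j.+1 <= n -> point n q j x z l < n.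
Proof.
move=> le_n; apply: leq_trans le_n.
by rewrite mulnC -ltn_divLR ?expn_gt0 ?q0 // point_block.
Qed.

End Point.

Lemma decode_inj v v' : v %/ q ^ k = v' %/ q ^ k -> base v = base v' -> vec v = vec v' -> v = v'.
Proof.
move=> eq_blk eq_base eq_vec; rewrite (divn_eq v (q ^ d)) (divn_eq v' (q ^ d)).
have inj a b : (a %% q)%:R%R = (b %% q)%:R%R :> F -> a %% q = b %% q.
  by move/(congr1 (fun h : F => h : nat)); rewrite !val_Fp_nat // !modn_mod.
congr (_ * _ + _).
  rewrite (divn_eq (v %/ _) q) (divn_eq (v' %/ _) q) -!divnMA -expnSr eq_blk.
  by congr (_ + _); exact: inj.
rewrite -!digits_expand //; apply: eq_bigr => i _; congr (_ * _); apply: inj.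
have := congr1 (fun f : Z => f (enum_val i)) eq_vec.
by rewrite !ffunE enum_valK.
Qed.

Lemma vec_surj (f : Z) : exists2 x, x < q ^ d & vec x = f.
Proof.
pose u (i : nat) := oapp (fun i' : 'I_d => val (f (enum_val i') : F)) 0 (insub i).
have lt_u i : i < d -> u i < q.
  move=> lt_i; rewrite /u insubT /=; have := ltn_ord (f (enum_val (Sub i lt_i)) : F).
  by rewrite [X in _ < X](Fp_cast q_pr).
exists (\sum_(i < d) u i * q ^ i); first exact: digits_lt.
apply/ffunP => i; rewrite ffunE.
have := digits_mod 0 lt_u (ltn_ord (enum_rank i)); rewrite mul0n add0n => ->.
rewrite /u (valK (enum_rank i)) /= enum_rankK.
exact: natr_Zp.
Qed.

End Fixed.
End Correctness.

Lemma two_points_line (F : fieldType) (V : lmodType F) (x1 z1 x2 z2 : V) (a b : F) : a != b ->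
  (x1 + a *: z1 = x2 + a *: z2 -> x1 + b *: z1 = x2 + b *: z2 -> x1 = x2 /\ z1 = z2)%R.
Proof.
move=> neq_ab eq_a eq_b; have eq_z : z1 = z2.
  apply: (@scalerI _ _ (a - b)%R); first by rewrite subr_eq0.
  have eqB (x z : V) : ((a - b) *: z = (x + a *: z) - (x + b *: z))%R.
    by rewrite scalerBl opprD addrACA subrr add0r.
  by rewrite (eqB x1) (eqB x2) eq_a eq_b.
by split=> //; move: eq_a; rewrite eq_z => /addIr.
Qed.

(** * The hypergraph of the listed edges *)

Section LineHypergraph.
Variable r : nat.
Notation M := (r.+1 * 2 ^ r).
Notation I := ('I_M + 'I_r * 'I_M * 'I_(2 ^ r))%type.
Notation d := #|{: I}|.
Notation k := d.+1.
Notation e := (2 * k).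

Variables (n q : nat).
Hypotheses (q_pr : prime q) (lt_qn : q < n) (q_le : q ^ e <= n).
Notation F := 'F_q.
Notation Z := {ffun I -> F^o}.
Notation vec := (@vec r q).
Notation base := (@base r q).

Let q0 : 0 < q := prime_gt0 q_pr.
Let le_qn : q <= n := ltnW lt_qn.
Let qd_le : q ^ d <= n.
Proof. by apply: (@pow_le_n r) => //; lia. Qed.

(** Membership in an edge through the field elements alone: edges with the same block and the same
    vectors have the same vertices. *)
Definition on_edge (j : nat) (x z : Z) (v : nat) := v %/ q ^ k = j /\
  exists2 l, base v = hash z l & vec v = (x + base v *: z)%R.

Lemma edge_listP j x z v : x < q ^ d -> z < q ^ d ->
  v \in edge_list r n q j x z <-> on_edge j (vec x) (vec z) v.
Proof.
move=> lt_x lt_z.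
have le_x : x <= n by apply: ltnW; apply: leq_trans qd_le.
have le_z : z <= n by apply: ltnW; apply: leq_trans qd_le.
split=> [/mapP[l _ ->]|[blk [l b_v v_v]]].
  split; first exact: point_block.
  by exists l; rewrite point_base // point_vec.
apply/mapP; exists l; first by rewrite mem_enum.
apply: (@decode_inj r q q_pr).
- by rewrite point_block.
- by rewrite point_base.
- rewrite b_v in v_v.
  exact: etrans v_v (esym (point_vec q_pr lt_qn q_le j l le_x le_z)).
Qed.

Variable Hg : {set {set 'I_n}}.
Hypothesis HgP : forall E, E \in Hg <-> exists j x z,
  [/\ (q ^ k * j.+1 <= n), (x < q ^ d), z < q ^ d, injective (hash (vec z)) &
      E = [set v : 'I_n | val v \in edge_list r n q j x z]].

Lemma line_uniform : uniform r Hg.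
Proof.
move=> E /HgP[j [x [z [le_j lt_x lt_z inj ->]]]].
have le_x : x <= n by apply: ltnW; apply: leq_trans qd_le.
have le_z : z <= n by apply: ltnW; apply: leq_trans qd_le.
have lt_p (l : 'I_r) : point n q j x z l < n.
  exact: point_lt.
have -> : [set v : 'I_n | val v \in edge_list r n q j x z] = [set Ordinal (lt_p l) | l : 'I_r].
  apply/setP => v; rewrite inE; apply/mapP/imsetP => -[l _ v_l]; exists l; rewrite ?mem_enum //.
    exact: val_inj.
  by rewrite v_l.
rewrite card_imset; first by rewrite card_ord.
move=> l1 l2 /(congr1 (fun v : 'I_n => base v)).
by rewrite [LHS]point_base // [RHS]point_base // => /inj.
Qed.

(** Two common vertices have the same block, hence distinct abscissas, since vertices with equal
    abscissas on one edge coincide. They determine [x] and [z], and thereby the edge, whose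
    abscissas depend on [z] only. *)
Lemma line_linear E1 E2 : E1 \in Hg -> E2 \in Hg -> E1 != E2 -> #|E1 :&: E2| < 2.
Proof.
move=> /HgP[j1 [x1 [z1 [le_j1 lt_x1 lt_z1 inj1 ->]]]].
move=> /HgP[j2 [x2 [z2 [le_j2 lt_x2 lt_z2 inj2 ->]]]].
rewrite ltnNge; apply: contraNN => /card_gt1P[v [v' [vin v'in neq_v]]].
move: vin v'in; rewrite !inE => /andP[v1 v2] /andP[v'1 v'2].
have {v1} [blk1 [l1 _ c1]] := (edge_listP _ _ lt_x1 lt_z1).1 v1.
have {v2} [blk2 [l2 _ c2]] := (edge_listP _ _ lt_x2 lt_z2).1 v2.
have {v'1} [blk1' [l1' _ c1']] := (edge_listP _ _ lt_x1 lt_z1).1 v'1.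
have {v'2} [blk2' [l2' _ c2']] := (edge_listP _ _ lt_x2 lt_z2).1 v'2.
have neq_b : base v != base v'.
  apply: contra neq_v => /eqP eq_b; apply/eqP/val_inj.
  apply: (@decode_inj r q q_pr _ _ _ eq_b); first by rewrite blk1 blk1'.
  rewrite c1 c1' eq_b; exact: erefl.
have [|| eq_x eq_z] := two_points_line (x1 := vec x1) (z1 := vec z1) (x2 := vec x2) (z2 := vec z2) neq_b.
- rewrite -c1 -c2; exact: erefl.
- rewrite -c1' -c2'; exact: erefl.
have eq_j : j1 = j2 by rewrite -blk1 -blk2.
apply/eqP/setP => u; rewrite !inE; apply/idP/idP.
  move=> /(edge_listP _ _ lt_x1 lt_z1) u1; apply/(edge_listP _ _ lt_x2 lt_z2).
  by rewrite -eq_j -eq_x -eq_z.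
move=> /(edge_listP _ _ lt_x2 lt_z2) u2; apply/(edge_listP _ _ lt_x1 lt_z1).
by rewrite eq_j eq_x eq_z.
Qed.

(** As [vec] is onto, every line with injective hash gives an edge in the complete block [j], and
    this edge is not contained in [S]. *)
Lemma no_line_edge_block (S : {set 'I_n}) j : independent Hg S -> q ^ k * j.+1 <= n ->
  @no_line_edge F r [set (base (val v), vec (val v)) | v in S & (val v) %/ q ^ k == j].
Proof.
move=> /forall_inP ind le_j x z inj.
have [X lt_X eq_x] := vec_surj q_pr x; have [Y lt_Y eq_z] := vec_surj q_pr z.
pose E := [set v : 'I_n | val v \in edge_list r n q j X Y].
have /ind /subsetPn[v] : E \in Hg.
  by apply/HgP; exists j, X, Y; split=> //; rewrite eq_z.
rewrite inE => /(edge_listP _ _ lt_X lt_Y)[blk [l b_v c_v]] vS.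
rewrite eq_x eq_z in b_v c_v; exists l; rewrite -b_v -c_v; apply: contra vS => /imsetP[v'].
rewrite inE => /andP[v'S /eqP blk'] [eq_b eq_c].
suff -> : v = v' by [].
apply/val_inj/(@decode_inj r q q_pr); last exact: eq_c; last exact: eq_b.
by rewrite blk blk'.
Qed.

(** [a] is the largest number of vertices of [S] in a complete block, bounded by
    [no_line_edge_card]. The summand [q ^ k] accounts for the incomplete last block. *)
Lemma independent_bound S : 0 < r -> independent Hg S -> exists2 a,
  q * a ^ r <= (2 ^ (r * r.+1) + r ^ 2) * (q ^ k) ^ r &
  #|S| <= n %/ q ^ k * a + q ^ k.
Proof.
move=> r0 ind; set c := 2 ^ _ + _; set B := n %/ q ^ k.
have qk0 : 0 < q ^ k by rewrite expn_gt0 q0.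
pose A j := [set (base (val v), vec (val v)) | v in S & (val v) %/ q ^ k == j].
have card_FZ : #|{: F * Z}| = q ^ k.
  by rewrite card_prod card_ffun /= card_Fp // expnS.
have card_A j : #|[set v in S | (val v) %/ q ^ k == j]| = #|A j|.
  rewrite /A; symmetry; apply: card_in_imset.
  move=> v v'; rewrite !inE => /andP[_ /eqP blk] /andP[_ /eqP blk'] [eq_b eq_c].
  apply/val_inj/(@decode_inj r q q_pr); last exact: eq_c; last exact: eq_b.
  by rewrite blk blk'.
exists (\max_(j < B) #|A j|).
  apply: (big_ind (fun a => q * a ^ r <= c * (q ^ k) ^ r)) => [|a b aP bP|j _].
  - by rewrite exp0n // muln0.
  - by case: (leqP a b) => _.
  have := no_line_edge_card (no_line_edge_block (j := j) ind _) r0.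
  rewrite card_ffun card_Fp // -expnS; apply.
  by rewrite mulnC -leq_divRL.
(* Classes [0, ..., B - 1] are the complete blocks; class [B] collects the vertices after them. *)
pose p (v : 'I_n) : 'I_B.+1 := inord (val v %/ q ^ k).
have pE v : p v = val v %/ q ^ k :> nat.
  by rewrite /p inordK // ltnS; apply: leq_div2r; exact: ltnW (ltn_ord v).
rewrite -sum1_card (partition_big p predT) //= big_ord_recr /=.
apply: leq_add.
  rewrite -[X in _ <= X * _]card_ord -sum_nat_const; apply: leq_sum => j _.
  rewrite sum1dep_card; apply: leq_trans (leq_bigmax j); rewrite -card_A.
  by apply/subset_leq_card/fintype.subsetP => v; rewrite !inE -val_eqE /= pE.
rewrite sum1dep_card -card_FZ; apply: leq_trans (max_card (mem (A B))); rewrite -card_A.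
by apply/subset_leq_card/fintype.subsetP => v; rewrite !inE -val_eqE /= pE.
Qed.

End LineHypergraph.

(** * Size of the prime and the bound for a given [n] *)

(** For the integer [e]-th root [i] of [n], [prime_interval] at [i./2] gives a prime [p <= i] with
    [i.+1 <= 36 * p ^ 2], while [n < i.+1 ^ e]. *)
Lemma prime_root n e : 0 < e -> 2 ^ e <= n ->
  exists p, [/\ prime p, p ^ e <= n & n <= 36 ^ e * p ^ (2 * e)].
Proof.
move=> e0 le_n; pose P i := i ^ e <= n.
have exP : exists i, P i by exists 2.
have ubP i : P i -> i <= n.
  by move=> le_i; apply: leq_trans le_i; case: i => // i; rewrite -[X in X <= _]expn1 leq_pexp2l.
case: (ex_maxnP exP ubP) => i Pi max_i.
have i2 : 2 <= i by exact: max_i.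
have [|p [p_pr le_p lt_p]] := @prime_interval i./2; first by rewrite half_gt0.
have le_pi : p <= i by apply: leq_trans le_p _; rewrite mul2n -[X in _ <= X]odd_double_half leq_addl.
exists p; split=> //; first by apply: leq_trans Pi; rewrite leq_exp2r.
have lt_n : n < i.+1 ^ e by rewrite ltnNge; apply/negP => /max_i; rewrite ltnn.
apply: ltnW; apply: leq_trans lt_n _.
rewrite expnM -expnMn leq_exp2r //.
have := odd_double_half i; rewrite -mul2n; have := half_gt0 i; rewrite i2.
by move: lt_p; case: (odd i) => /=; move: (i./2) => h; nia.
Qed.

(** Let [b] be the part of the bound from complete blocks. Raising [q * b ^ r <= c * n ^ r] to the
    power [2 * e] and using that [q ^ (2 * e)] is at least [n / 36 ^ e] saves one factor [n]. The
    remainder [v = q ^ k] satisfies [v ^ 2 <= n]. *)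
Lemma density_bound q k e r c n a u : 0 < k -> 0 < r -> 0 < n -> e = 2 * k ->
    q ^ e <= n -> n <= 36 ^ e * q ^ (2 * e) -> q * a ^ r <= c * (q ^ k) ^ r ->
    u <= n %/ q ^ k * a + q ^ k ->
  u ^ (r * (2 * e)) <= 2 ^ (r * (2 * e)) * (36 ^ e * c ^ (2 * e) + 1) * n ^ (r * (2 * e) - 1).
Proof.
move=> k0 r0 n0 eE q_le n_le a_le u_le; set L := r * (2 * e).
have e0 : 0 < e by rewrite eE muln_gt0.
have L0 : 0 < L by rewrite /L !muln_gt0 r0 e0.
set b := n %/ q ^ k * a in u_le; set v := q ^ k in u_le.
have b_le : q * b ^ r <= c * n ^ r.
  rewrite /b expnMn mulnCA; apply: leq_trans (leq_mul (leqnn _) a_le) _.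
  by rewrite mulnCA leq_mul2l -expnMn leq_exp2r // leq_trunc_div orbT.
have bL : b ^ L <= 36 ^ e * c ^ (2 * e) * n ^ (L - 1).
  rewrite -(leq_pmul2l n0); apply: leq_trans (leq_mul n_le (leqnn _)) _.
  have -> : n * (36 ^ e * c ^ (2 * e) * n ^ (L - 1)) = 36 ^ e * (c * n ^ r) ^ (2 * e).
    by rewrite expnMn -expnM mulnCA -expnS subn1 prednK // mulnA.
  rewrite -mulnA leq_mul2l; apply/orP; right.
  by rewrite /L [b ^ _]expnM -expnMn leq_exp2r // muln_gt0.
have vL : v ^ L <= n ^ (L - 1).
  have -> : L = 2 * (r * e) by rewrite /L; ring.
  rewrite expnM; apply: leq_trans (_ : n ^ (r * e) <= _).
    rewrite leq_exp2r ?muln_gt0 ?r0 //; apply: leq_trans q_le.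
    by rewrite /v -expnM eE mulnC.
  have re0 : 0 < r * e by rewrite muln_gt0 r0.
  by rewrite leq_pexp2l //; lia.
apply: leq_trans (_ : (2 * maxn b v) ^ L <= _).
  by rewrite leq_exp2r // mul2n -addnn; apply: leq_trans u_le _; rewrite leq_add ?leq_maxl ?leq_maxr.
rewrite expnMn -mulnA leq_mul2l; apply/orP; right; rewrite mulnDl mul1n.
case: (leqP b v) => _; first exact: leq_trans vL (leq_addl _ _).
exact: leq_trans bL (leq_addr _ _).
Qed.

Section Construction.
Variable r : nat.
Notation M := (r.+1 * 2 ^ r).
Notation I := ('I_M + 'I_r * 'I_M * 'I_(2 ^ r))%type.
Notation d := #|{: I}|.
Notation k := d.+1.
Notation e := (2 * k).
Notation L := (r * (2 * e)).
(** The first summand is the constant of [density_bound]; [2 ^ e] covers those [n] for which no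
    prime fits. *)
Notation K := (2 ^ L * (36 ^ e * (2 ^ (r * r.+1) + r ^ 2) ^ (2 * e) + 1) + 2 ^ e).

(** Uniqueness of the chosen prime removes [q] from the existential description of the output. *)
Lemma all_edges_chosen n q (ls : seq (seq nat)) : q < n -> chosen n e q ->
    (forall l, l \in ls <-> exists q j x z,
      [/\ [&& q < n, j < n, x < n & z < n],
      [&& chosen n e q, mulc n (powc n q k) j.+1 <= n, x < powc n q d, z < powc n q d
        & distinct r n q z] & l = edge_list r n q j x z]) ->
  forall l, l \in ls <-> exists j x z,
  [/\ (q ^ k * j.+1 <= n), (x < q ^ d), z < q ^ d, injective (hash (vec r q z)) &
      l = edge_list r n q j x z].
Proof.
move=> lt_qn cq lsP l; have [q_pr q_le q_max] := chosenP lt_qn cq.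
have le_qn := ltnW lt_qn; have q0 := prime_gt0 q_pr.
have qd_le : q ^ d <= n by apply: (@pow_le_n r) => //; lia.
rewrite lsP; split.
  case=> q' [j [x [z [/and4P[lt_q'n lt_j lt_x lt_z] /and5P[cq' le_j ltx ltz dz] ->]]]].
  have [q'_pr q'_le q'_max] := chosenP lt_q'n cq'.
  have eq_q : q' = q by apply/eqP; rewrite eqn_leq q_max // q'_max.
  subst q'; move: le_j ltx ltz; rewrite !powcE // mulcE // => le_j ltx ltz.
  exists j, x, z; split=> //; apply/(@distinctP r n q q_pr lt_qn q_le _ _) => //; exact: ltnW.
case=> j [x [z [le_j ltx ltz inj ->]]].
have lt_j : j < n by apply: leq_trans le_j; rewrite leq_pmull // expn_gt0 q0.
have lt_x := leq_trans ltx qd_le; have lt_z := leq_trans ltz qd_le.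
exists q, j, x, z; split=> //; first by rewrite lt_qn lt_j lt_x lt_z.
rewrite cq !powcE // mulcE // le_j ltx ltz /=.
by apply/(@distinctP r n q q_pr lt_qn q_le _ _) => //; exact: ltnW.
Qed.

Lemma construction_at n : r <= n -> 2 <= r -> exists Hg : {set {set 'I_n}},
  [/\ lists_edges r (all_edges r n) Hg, uniform r Hg,
      forall E1 E2, E1 \in Hg -> E2 \in Hg -> E1 != E2 -> #|E1 :&: E2| < 2
    & independence_number Hg ^ L <= K * n ^ (L - 1)].
Proof.
move=> le_rn r2; have r0 : 0 < r by exact: ltnW.
have n0 : 0 < n by exact: leq_trans le_rn.
have e0 : 0 < e by rewrite muln_gt0.
have e1 : 1 < e by rewrite mulnS.
have L0 : 0 < L by rewrite !muln_gt0 r0.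
have alpha_max (Hg : {set {set 'I_n}}) : (forall S, independent Hg S -> #|S| ^ L <= K * n ^ (L - 1)) ->
    independence_number Hg ^ L <= K * n ^ (L - 1).
  move=> HgS; rewrite /independence_number.
  apply: (big_ind (fun a => a ^ L <= K * n ^ (L - 1))) => [|a b aP bP|S]; last exact: HgS.
    by rewrite exp0n.
  by case: (leqP a b) => _.
have [ls ls_eq lsP] := all_edgesP r n.
have es_edges (es : seq (r.-tuple 'I_n)) : [seq [seq val v | v <- tval t] | t <- es] = ls ->
  forall E, E \in [set [set v in tval t] | t in es] <->
    exists2 l, l \in ls & E = [set v : 'I_n | val v \in l].
  move=> es_ls E.
  have setE (t : r.-tuple 'I_n) : [set v in tval t] =
      [set v : 'I_n | val v \in [seq val v' | v' <- tval t]].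
    by apply/setP => v; rewrite !inE mem_map //; exact: val_inj.
  split=> [/imsetP[t t_es ->]|[l]].
    exists [seq val v | v <- tval t]; last exact: setE.
    by rewrite -es_ls; apply/mapP; exists t.
  by rewrite -es_ls => /mapP[t t_es ->] ->; apply/imsetP; exists t.
case: (pickP (fun q : 'I_n => chosen n e q)) => [q cq|no_q].
  have lt_qn := ltn_ord q; have lsP' := all_edges_chosen lt_qn cq lsP.
  have [q_pr q_le q_max] := chosenP lt_qn cq.
  have qd_le : q ^ d <= n by apply: (@pow_le_n r) => //; lia.
  have [l|es es_ls] := @ordinal_tuples n r ls.
    move=> /lsP'[j [x [z [le_j lt_x lt_z _ ->]]]].
    split; first by rewrite size_map size_enum_ord.
    move=> v /mapP[i _ ->]; apply: point_lt => //.
      by apply: ltnW; apply: leq_trans qd_le.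
    by apply: ltnW; apply: leq_trans qd_le.
  have HgP E : E \in [set [set v in tval t] | t in es] <-> exists j x z,
    [/\ (q ^ k * j.+1 <= n), (x < q ^ d), z < q ^ d, injective (hash (vec r q z)) &
      E = [set v : 'I_n | val v \in edge_list r n q j x z]].
    rewrite (es_edges es es_ls); split.
      by case=> l /lsP'[j [x [z [h1 h2 h3 h4 ->]]]] ->; exists j, x, z.
    case=> j [x [z [h1 h2 h3 h4 ->]]]; exists (edge_list r n q j x z) => //.
    by apply/lsP'; exists j, x, z.
  exists [set [set v in tval t] | t in es]; split.
  - by exists es; rewrite es_ls.
  - exact: (line_uniform q_pr lt_qn q_le HgP).
  - exact: (line_linear q_pr lt_qn q_le HgP).
  apply: alpha_max => S indS.
  have [a a_le S_le] := independent_bound q_pr lt_qn q_le HgP r0 indS.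
  rewrite mulnDl; apply: leq_trans (leq_addr _ _).
  apply: (@density_bound q k e r _ n a) => //.
  (* The prime given by [prime_root] is at most [q] by maximality, so its lower bound passes to
     [q]. *)
  have [|lt_n2] := leqP (2 ^ e) n; last first.
    apply: leq_trans (ltnW lt_n2) _; apply: leq_trans (leq_pmulr _ _); last first.
      by rewrite expn_gt0 prime_gt0.
    by rewrite leq_exp2r.
  move=> /(prime_root e0)[p [p_pr p_le n_le]]; apply: leq_trans n_le _.
  rewrite leq_mul2l leq_exp2r ?muln_gt0 //; apply/orP; right; apply: q_max => //.
  by apply: leq_trans p_le; rewrite -[X in X < _]expn1 ltn_exp2l // prime_gt1.
(* Without a chosen prime nothing is printed. Then [n < 2 ^ e] by [prime_root], and the trivial
   bound [n] on independent sets suffices. *)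
have ls0 : ls = [::].
  case: ls lsP {ls_eq es_edges} => // l ls /(_ l) [/(_ (mem_head _ _))].
  case=> q [j [x [z [/and4P[lt_q _ _ _] /andP[cq _] _]]]] _.
  by have := no_q (Ordinal lt_q); rewrite /= cq.
exists finset.set0; split.
- exists [::]; split; first by rewrite ls_eq ls0.
  by apply/setP => E; rewrite inE; apply/esym/negP => /imsetP[].
- by move=> E; rewrite inE.
- by move=> E1 E2; rewrite inE.
apply: alpha_max => S _.
have lt_n2 : n < 2 ^ e.
  rewrite ltnNge; apply/negP => /(prime_root e0)[p [p_pr p_le _]].
  have lt_pn : p < n.
    by apply: leq_trans p_le; rewrite -[X in X < _]expn1 ltn_exp2l // prime_gt1.
  have [q lt_qn cq] := chosen_ex p_pr lt_pn p_le.
  by have := no_q (Ordinal lt_qn); rewrite /= cq.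
rewrite mulnDl; apply: leq_trans (leq_addl _ _).
apply: leq_trans (_ : n ^ L <= _).
  by rewrite leq_exp2r // -[X in _ <= X]card_ord max_card.
by rewrite -[X in n ^ X]prednK // expnS subn1 leq_mul2r (ltnW lt_n2) orbT.
Qed.

End Construction.

(** * Constants uniform in [r] and the real exponent *)

Lemma linear_construction r s : 2 <= s -> s <= r -> exists K L, 0 < L /\
  explicit_construction r s (fun n Hg => independence_number Hg ^ L <= K * n ^ (L - 1)).
Proof.
move=> s2 le_sr; have r2 := leq_trans s2 le_sr.
have [p [c [kk pP]]] := exec_all_edges r.
eexists; eexists; split; last first.
  (* The factor [2 ^ kk] replaces the base [n.+1] by [n], as [n.+1 <= 2 * n]. *)
  exists p, (c * 2 ^ kk), kk => n le_rn.
  have [t [st [et let_ ot]]] := pP n.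
  have [Hg [lists unif lin alpha]] := construction_at le_rn r2.
  exists t, st, Hg; split=> //; last exact: alpha.
  - apply: leq_trans let_ _; apply: leq_trans (leq_addr _ _).
    rewrite -mulnA leq_mul2l -expnMn; apply/orP; right.
    have n0 : 0 < n by apply: leq_trans le_rn; exact: ltnW.
    by case: (kk) => // kk'; rewrite leq_exp2r // mul2n -addnn -addn1 leq_add2l.
  - by rewrite ot.
  - split=> //; first by rewrite le_sr ltnW.
    by move=> E1 E2 E1in E2in neq; apply: leq_trans s2; exact: lin.
by rewrite !muln_gt0 (ltnW r2).
Qed.

Lemma explicit_construction_mono r s (P Q : forall n, {set {set 'I_n}} -> Prop) :
    (forall n (Hg : {set {set 'I_n}}), r <= n -> P n Hg -> Q n Hg) ->
  explicit_construction r s P -> explicit_construction r s Q.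
Proof.
move=> PQ [p [c [k pP]]]; exists p, c, k => n le_rn.
have [t [st [Hg [? ? ? ? P_Hg]]]] := pP n le_rn.
by exists t, st, Hg; split=> //; exact: PQ.
Qed.

Lemma independence_number_le n (Hg : {set {set 'I_n}}) : independence_number Hg <= n.
Proof. by apply/bigmax_leqP => S _; rewrite -[X in _ <= X]card_ord max_card. Qed.

(** The hypothesis is multiplied by [a ^ (L' - L) <= n ^ (L' - L)]. This allows bounds for several
    [r] to share their constants. *)
Lemma power_bound_mono a n K K' L L' : a <= n -> 0 < L -> K <= K' -> L <= L' ->
  a ^ L <= K * n ^ (L - 1) -> a ^ L' <= K' * n ^ (L' - 1).
Proof.
move=> le_an L0 le_K le_L le_a; rewrite -(subnKC le_L) -addnBAC // !expnD mulnA.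
apply: leq_mul; first by apply: leq_trans le_a _; rewrite leq_mul2r le_K orbT.
by case: (L' - L) => // m; rewrite leq_exp2r.
Qed.

(** The constants must be fixed before [r]. Only finitely many [r] occur, so induction on [R] adds
    up the constants of the individual constructions. *)
Lemma linear_construction_upto s R : 2 <= s -> exists K L, 0 < L /\
  forall r, s <= r -> r <= R ->
    explicit_construction r s (fun n Hg => independence_number Hg ^ L <= K * n ^ (L - 1)).
Proof.
move=> s2; elim: R => [|R [K [L [L0 KL]]]].
  by exists 0, 1; split=> // r le_sr; rewrite leqn0 => /eqP r0; rewrite r0 in le_sr; lia.
have [le_sR|lt_Rs] := leqP s R.+1; last first.
  by exists K, L; split=> // r le_sr le_rR; have := leq_trans le_sr le_rR; rewrite leqNgt lt_Rs.
have [K' [L' [L'0 KL']]] := linear_construction s2 le_sR.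
exists (K + K'), (L + L'); split=> [|r le_sr le_rR]; first by rewrite addn_gt0 L0.
move: le_rR; rewrite leq_eqVlt => /orP[/eqP->|le_rR].
  apply: explicit_construction_mono KL' => n Hg _.
  by apply: power_bound_mono; rewrite ?independence_number_le ?leq_addl.
apply: explicit_construction_mono (KL r le_sr le_rR) => n Hg _.
by apply: power_bound_mono; rewrite ?independence_number_le ?leq_addr.
Qed.

(** An [L]-th root is taken; [K] may stay in front of it because [K <= K ^ L]. *)
Lemma power_bound_powR (R : realType) a n K L : 0 < K -> 0 < L ->
  a ^ L <= K * n ^ (L - 1) -> (a%:R <= K%:R * n%:R `^ (1 - L%:R^-1) :> R)%R.
Proof.
move=> K0 L0; rewrite -(ler_nat R) natrM !natrX => le_a.
rewrite -(ler_pXn2r L0) ?nnegrE ?mulr_ge0 ?powR_ge0 //.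
apply: le_trans le_a _; rewrite exprMn -[X in (_ <= _ * X)%R]powR_mulrn ?powR_ge0 //.
rewrite -powRrM mulrBl mul1r mulVf ?pnatr_eq0 -?lt0n //.
have -> : (L%:R - 1 = (L - 1)%:R :> R)%R by rewrite natrB.
rewrite powR_mulrn // ler_wpM2r ?exprn_ge0 // -[X in (X <= _)%R]expr1 ler_weXn2l //.
by rewrite ler1n.
Qed.

Theorem theorem1p6 (R : realType) (l1 l2 l3 l4 : nat) :
  exists C eps : R, [/\ (0 < C)%R, (0 < eps)%R &
    forall r : nat,
      2 * s_of l1 l2 l3 l4 <= r -> r <= R_of l1 l2 l3 l4 ->
      explicit_construction r (s_of l1 l2 l3 l4)
        (fun (n : nat) (H : {set {set 'I_n}}) =>
          ((independence_number H)%:R <= C * (n%:R `^ (1 - eps)))%R)].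
Proof.
set s := s_of l1 l2 l3 l4.
have s2 : 2 <= s by rewrite /s /s_of addn1 ltnS !muln_gt0 !expn_gt0.
have [K [L [L0 KL]]] := linear_construction_upto (R_of l1 l2 l3 l4) s2.
(* The saving [1 / L] is the [eps] of the theorem; [K.+1] guarantees a positive constant. *)
exists K.+1%:R%R, L%:R^-1%R; split; rewrite ?ltr0Sn ?invr_gt0 ?ltr0n // => r le_sr le_rR.
have le_sr' : s <= r by apply: leq_trans le_sr; rewrite leq_pmull.
apply: explicit_construction_mono (KL r le_sr' le_rR) => n Hg _ le_a.
apply: power_bound_powR => //; apply: leq_trans le_a _.
by rewrite leq_mul2r leqnSn orbT.
Qed.
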